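(* Let $r,s$ be positive integers and let $R$ be the row superstandard tableau of shape $(r,1^{s-1})$. Then, for all $n$, $$Q_n(K(R))=\sum_{\lambda\vdash n} c_\lambda s_\lambda,$$ where $s_\lambda$ is the Schur function and $c_\lambda$ is the number of $P\in\mathrm{Av}_n(r,s)$ of shape $\lambda$.
   Context: $\mathfrak S_n$ is the set of permutations $\pi=\pi_1\cdots\pi_n$ of $[n]=\{1,\dots,n\}$. A permutation $\sigma$ contains $\pi$ if some (not necessarily contiguous) subsequence of $\sigma$ is order isomorphic to $\pi$; otherwise it avoids $\pi$. $\mathfrak S_n(\Pi)$ is the set of $\sigma\in\mathfrak S_n$ avoiding every $\pi\in\Pi$. The descent set of $\sigma\in\mathfrak S_n$ is $\mathrm{Des}\,\sigma=\{i\in[n-1]\mid \sigma_i>\sigma_{i+1}\}$. For $S\subseteq[n-1]$ the fundamental quasisymmetric function (of degree $n$, in variables $x_1,x_2,\dots$) is $F_S=\sum x_{i_1}\cdots x_{i_n}$, the sum over all $i_1\le\cdots\le i_n$ with $i_j<i_{j+1}$ whenever $j\in S$. Define $Q_n(\Pi)=\sum_{\sigma\in\mathfrak S_n(\Pi)}F_{\mathrm{Des}\,\sigma}$. Young diagrams are in English notation (first row on top), with boxes indexed by (row, column) as in a matrix; $p_{i,j}$ is the entry of $P$ in box $(i,j)$. $\mathrm{SYT}(n)$ is the set of standard Young tableaux with $n$ boxes (entries $1,\dots,n$, rows and columns increasing). $P(\pi)$ denotes the insertion tableau of $\pi$ under the Robinson–Schensted correspondence, and for a standard Young tableau $P$,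 $K(P)=\{\pi\mid P(\pi)=P\}$ is its Knuth class. A standard tableau of shape $\lambda$ is row superstandard if its first row is $1,\dots,\lambda_1$, its second row is $\lambda_1+1,\dots,\lambda_1+\lambda_2$, and so on. An $(r,s)$-ascending sequence in $P$ is a sequence of entries of $P$ of the form $p_{1,r}=p_{i_1,j_1}<p_{i_2,j_2}<\cdots<p_{i_s,j_s}$ with $1=i_1<i_2<\cdots<i_s$. $\mathrm{Av}_n(r,s)$ is the set of $P\in\mathrm{SYT}(n)$ that do not contain an $(r,s)$-ascending sequence. *)

(* Defs.v *)
From HB Require Import structures.
From mathcomp Require Import all_boot all_order all_fingroup all_algebra.
From mathcomp Require Import finmap multiset.
From mathcomp Require Import boolp classical_sets functions cardinality fsbigop.

Set Implicit Arguments.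
Unset Strict Implicit.
Unset Printing Implicit Defensive.

Import GRing.Theory.

Local Open Scope classical_set_scope.
Local Open Scope nat_scope.

(* ['I_n] is 0-based: positions and values of [s : 'S_n] are shifted by one
   with respect to [n] = {1, ..., n}. The word s_1 ... s_n has letters in
   {1, ..., n}. *)
Definition word n (s : 'S_n) : seq nat := [seq (val (s i)).+1 | i <- enum 'I_n].

Definition contains n k (s : 'S_n) (p : 'S_k) : bool :=
  [exists f : {ffun 'I_k -> 'I_n},
    [forall i : 'I_k, forall j : 'I_k, (i < j) ==> (f i < f j)] &&
    [forall i : 'I_k, forall j : 'I_k, (s (f i) < s (f j)) == (p i < p j)]].

Definition avoiders n k (Pi : {set 'S_k}) : {set 'S_n} :=
  [set s | [forall p in Pi, ~~ contains s p]].

(* The element j of 'I_n.-1 stands for the position j + 1 of [n - 1]. *)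
Definition Des n (s : 'S_n) : {set 'I_n.-1} :=
  [set j : 'I_n.-1 | nth 0 (word s) j.+1 < nth 0 (word s) j].

(* A monomial in x_1, x_2, ... is the multiset of its variables, k : nat
   standing for x_{k+1}; a formal power series maps a monomial to its
   coefficient. Addition of series is the pointwise one on functions. *)
Notation monomial := {mset nat}%mset.
Notation fps := (monomial -> int).

(* The sum of the monomials [x a], a in A. It is meaningful only when each
   monomial is reached finitely often (fset_set is empty on infinite sets),
   which is the case below since the monomial bounds the entries of a. *)
Definition monomial_sum (T : choiceType) (A : set T) (x : T -> monomial) :
    fps :=
  fun m => Posz #|` fset_set [set a | A a /\ x a = m]|%fset.

Definition fundamental n (S : {set 'I_n.-1}) : fps :=
  monomial_sum
    [set t : n.-tuple nat | sorted leq t /\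
       forall j : 'I_n.-1, j \in S -> nth 0 t j < nth 0 t j.+1]
    (fun t => seq_mset (tval t)).

Definition Q n k (Pi : {set 'S_k}) : fps :=
  (\sum_(s in avoiders n Pi) fundamental (Des s))%R.

Definition is_partition (n : nat) (la : seq nat) : bool :=
  [&& sorted geq la, 0 \notin la & sumn la == n].

(* A filling is the list of its rows, first row on top. Boxes are 0-based:
   p_{i+1,j+1} is [entry P i j]. *)
Notation filling := (seq (seq nat)).

Definition in_diagram (P : filling) (i j : nat) : bool :=
  j < size (nth [::] P i).

Definition entry (P : filling) (i j : nat) : nat := nth 0 (nth [::] P i) j.

Definition columns_increasing (P : filling) : Prop :=
  forall i j, in_diagram P i.+1 j -> entry P i j < entry P i.+1 j.

Definition SYT (n : nat) : set (filling) :=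
  [set P | [/\ is_partition n (shape P), perm_eq (flatten P) (iota 1 n),
              all (sorted ltn) P & columns_increasing P]].

Definition SSYT (la : seq nat) : set (filling) :=
  [set T | [/\ shape T = la, all (sorted leq) T & columns_increasing T]].

Definition schur (la : seq nat) : fps :=
  monomial_sum (SSYT la) (fun T => seq_mset (flatten T)).

Definition row_superstandard (la : seq nat) : filling :=
  reshape la (iota 1 (sumn la)).

(* Schensted row insertion: x replaces the leftmost larger entry of the row,
   which is then inserted into the next row. *)
Fixpoint insert (P : filling) (x : nat) : filling :=
  if P is row :: P' then
    let k := find (fun y => x < y) row in
    if k < size row then set_nth 0 row k x :: insert P' (nth 0 row k)
    else rcons row x :: P'
  else [:: [:: x]].

Definition insertion_tableau n (s : 'S_n) : filling :=
  foldl insert [::] (word s).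

Definition knuth_class (P : filling) : {set 'S_(sumn (shape P))} :=
  [set s | insertion_tableau s == P].

(* [b] lists the boxes (i_1, j_1), ..., (i_s, j_s). *)
Definition has_ascending (r s : nat) (P : filling) : Prop :=
  in_diagram P 0 r.-1 /\
  exists b : seq (nat * nat),
    [/\ size b = s /\ all (fun c => in_diagram P c.1 c.2) b,
        (head (0, 0) b).1 = 0,
        entry P (head (0, 0) b).1 (head (0, 0) b).2 = entry P 0 r.-1,
        sorted (fun c d => c.1 < d.1) b &
        sorted (fun c d => entry P c.1 c.2 < entry P d.1 d.2) b].

Definition Av (n r s : nat) : set (filling) :=
  [set P | SYT n P /\ ~ has_ascending r s P].

(* The set is finite, so that fset_set does not collapse it. *)
Definition Av_count (n r s : nat) (la : seq nat) : nat :=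
  #|` fset_set [set P | Av n r s P /\ shape P = la]|%fset.

(* Main.v *)
Require Import Defs.
From mathcomp Require Import all_boot all_order all_fingroup all_algebra.
From mathcomp Require Import finmap multiset.
From mathcomp Require Import boolp classical_sets functions cardinality fsbigop.
From mathcomp Require Import zify.

(** Write K(R) for the Knuth class of the hook tableau R. The letter r of a
    member of K(R) ends an increasing subsequence of length r and a decreasing
    subsequence of length s, and this property characterises K(R) among the
    permutations of r + s - 1 letters. Hence a permutation contains a member of
    K(R) if and only if it has a [peak]: a letter that ends both an increasing
    subsequence of length at least r and a decreasing one of length at least s
    ([contains_knuth_class]).

    Having a peak is invariant under Knuth moves ([peak_knuth]), and row
    insertion changes the row reading word of a tableau by Knuth moves
    ([knuth_insert]); so it can be tested on the reading word of the insertion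
    tableau P. There, increasing subsequences move strictly to the right
    through the columns and decreasing ones move strictly upwards through the
    rows, and a peak is the same thing as an (r,s)-ascending sequence
    ([peak_reading_word]). The same test, applied to permutations of r + s - 1
    letters, identifies the patterns: a tableau of that size with an ascending
    sequence has no room to differ from R ([hook_of_ascending]).

    Thus the avoiders are the permutations whose insertion tableau lies in
    Av(r,s). The series F_(Des q) enumerates the weakly increasing sequences t
    that increase strictly at the descents of q, that is, the sequences for
    which the two-line array with rows t and q is sorted lexicographically.
    The RSK correspondence ([rsk_spec], [rsk_inj], [rsk_surj]) maps such arrays
    bijectively to pairs (P, T) where P is the insertion tableau of q and T is
    a semistandard tableau of the same shape and with the same content as t.
    Comparing coefficients of a monomial ([count_terms]) gives the theorem. *)

Set Implicit Arguments.
Unset Strict Implicit.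
Unset Printing Implicit Defensive.

Local Open Scope classical_set_scope.
Local Open Scope nat_scope.

(** * Tableaux and row insertion *)

(** Two consecutive rows of a tableau: the columns increase from [u] to [v], and
    [v] is at most as long as [u]. Together with the increase of rows this
    expresses standardness and semistandardness alike, and it lends itself to
    induction on the rows. *)
Fixpoint above (u v : seq nat) : bool :=
  match u, v with
  | _, [::] => true
  | [::], _ :: _ => false
  | x :: u', y :: v' => (x < y) && above u' v'
  end.

Lemma aboveP u v :
  reflect (size v <= size u /\
           forall j, j < size v -> nth 0 u j < nth 0 v j) (above u v).
Proof.
elim: u v => [|x u IHu] [|y v] /=; try by constructor; split.
  by constructor; case.
apply: (iffP andP) => [[lt_xy /IHu[le_vu lt_uv]]|[le_vu lt_uv]].
  by split=> // -[|j] //= /lt_uv.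
split; first exact: (lt_uv 0).
by apply/IHu; split=> // j /(lt_uv j.+1).
Qed.

(** The relation [e] is [ltn] for insertion tableaux and [leq] for semistandard
    recording tableaux. The entries are arbitrary, so that the rows below the
    first one again form a tableau. *)
Definition tableau (e : rel nat) (P : filling) : bool :=
  [&& [::] \notin P, all (sorted e) P & sorted above P].

Lemma tableau_cons e row P :
  tableau e (row :: P) =
  [&& row != [::], sorted e row, above row (head [::] P) & tableau e P].
Proof.
rewrite /tableau inE negb_or /= eq_sym; case: (row != _) => //=.
have path_above : path above row P = above row (head [::] P) && sorted above P.
  by case: P => //=; case: row.
rewrite path_above; case: (row != _); case: (sorted e row) => //=;
  by case: (above _ _) => //=; rewrite ?andbF.
Qed.

Lemma sorted_mid_trans (A : eqType) (e : rel A) u x v : transitive e ->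
  sorted e (u ++ x :: v) =
  [&& sorted e u, sorted e v, all (e^~ x) u & all (e x) v].
Proof.
move=> e_tr.
rewrite !(sorted_pairwise e_tr) pairwise_cat allrel_consr /=.
have [/allP u_lt|] := boolP (all _ u); last by rewrite /= !andbF.
have [/allP v_lt|] := boolP (all _ v); last by rewrite /= !andbF.
have -> : allrel e u v.
  by apply/allrelP => y z /u_lt /= lt_yx /v_lt /=; apply: e_tr.
by rewrite !andbT.
Qed.

Lemma sorted_mid u x v :
  sorted ltn (u ++ x :: v) =
  [&& sorted ltn u, sorted ltn v, all (gtn x) u & all (ltn x) v].
Proof. exact/sorted_mid_trans/ltn_trans. Qed.

(** The row in which the shape grows when [x] is inserted in [P]; it is the
    information that the recording tableau stores. *)
Fixpoint new_row (P : filling) (x : nat) : nat :=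
  if P is row :: P' then
    let k := find (fun y => x < y) row in
    if k < size row then (new_row P' (nth 0 row k)).+1 else 0
  else 0.

(** The rows alone determine the bumping path of [x], and distinct entries make
    every comparison along it strict. *)
Definition insertable (P : filling) (x : nat) : bool :=
  all (sorted ltn) P && uniq (x :: flatten P).

Variant insert_spec (row : seq nat) (P : filling) (x : nat) :
    filling -> nat -> Prop :=
  | InsertEnd of all (gtn x) row & sorted ltn (rcons row x) :
      insert_spec row P x (rcons row x :: P) 0
  | InsertBump u y v of row = u ++ y :: v & x < y & insertable P y
      & sorted ltn (u ++ y :: v) & sorted ltn (u ++ x :: v) :
      insert_spec row P x ((u ++ x :: v) :: insert P y) (new_row P y).+1.

Lemma insertP row P x : insertable (row :: P) x ->
  insert_spec row P x (insert (row :: P) x) (new_row (row :: P) x).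
Proof.
case/andP=> /= /andP[row_lt P_lt].
rewrite cat_uniq mem_cat negb_or -andbA => /and4P[xrow xP row_uniq /andP[/hasPn rowP uniqP]].
set p := fun y => x < y; have [has_p|] := ltnP (find p row) (size row).
  have lt_x : p (nth 0 row (find p row)) by apply: nth_find; rewrite has_find.
  have /hasPn le_x : ~~ has p (take (find p row) row).
    by rewrite has_take -?leqNgt // has_find.
  have row_eq := cat_take_drop (find p row) row.
  rewrite (drop_nth 0) // in row_eq.
  move: (row_lt); rewrite set_nthE has_p -{1}row_eq sorted_mid.
  case/and4P=> u_sort v_sort lt_u lt_v; apply: InsertBump => //.
  - rewrite /insertable P_lt /= uniqP andbT; apply/negP => /rowP; rewrite /= mem_nth //.
  - by rewrite row_eq.
  rewrite sorted_mid u_sort v_sort /=; apply/andP; split; apply/allP => y.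
    move=> y_row; rewrite /= ltn_neqAle leqNgt le_x // andbT.
    by apply: contraNneq xrow => <-; apply: mem_take y_row.
  by move/(allP lt_v); apply: ltn_trans.
rewrite leqNgt -has_find => /hasPn row_le.
have all_lt : all (gtn x) row.
  apply/allP => y y_row; rewrite /= ltn_neqAle leqNgt (row_le y) // andbT.
  by apply: contraNneq xrow => <-.
apply: InsertEnd => //; rewrite -cats1 sorted_mid row_lt all_lt //.
Qed.

Lemma perm_mid (u v s s' : seq nat) x y : perm_eq s (y :: s') ->
  perm_eq ((u ++ x :: v) ++ s) (x :: (u ++ y :: v) ++ s').
Proof.
by move/seq.permP=> s_perm; apply/seq.permP => p; rewrite /= !count_cat s_perm /=; lia.
Qed.

Lemma insertable_insert P x : insertable P x ->
  all (sorted ltn) (insert P x) /\ perm_eq (flatten (insert P x)) (x :: flatten P).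
Proof.
elim: P x => [|row P IHP] x xP; first by rewrite /= perm_refl.
case: (insertP xP) => [_ row_lt|u y v -> lt_xy yP row_lt row'_lt].
  case/andP: xP => /= /andP[_ ->] _; rewrite row_lt; split=> //.
  by rewrite -cats1 -catA perm_catCA /=.
have [P'_lt P'_perm] := IHP y yP; split; first by rewrite /= P'_lt row'_lt.
exact: perm_mid.
Qed.

Lemma insert_insertable P x x' :
  insertable P x -> x' \notin x :: flatten P -> insertable (insert P x) x'.
Proof.
move=> xP x'P; have [P_lt /[dup] /perm_mem P_mem P_perm] := insertable_insert xP.
rewrite /insertable P_lt /= P_mem x'P (perm_uniq P_perm).
by case/andP: xP.
Qed.

(** The bumping paths of an increasing pair of letters do not cross: in each row
    the second letter bumps a larger letter than the first one did, or none. *)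
Lemma new_row_ltn P x x' : insertable P x -> x' \notin flatten P -> x < x' ->
  new_row (insert P x) x' <= new_row P x.
Proof.
elim: P x x' => [|row P IHP] x x' xP x'P lt_xx'; first by rewrite /= [x' < x]ltnNge (ltnW lt_xx').
have x'xP : x' \notin x :: flatten (row :: P).
  by rewrite inE negb_or x'P andbT neq_ltn lt_xx' orbT.
move: (insert_insertable xP x'xP) x'P.
case: (insertP xP) => [row_lt _ x'P _|u y v -> lt_xy yP row_lt row'_lt x'P'].
  case: (insertP x'P) => // u y v row_eq lt_x'y.
  have : y \in rcons row x by rewrite row_eq mem_cat mem_head orbT.
  by rewrite mem_rcons inE => /predU1P[|/(allP row_lt) /=]; lia.
move=> _; move: x'P'; case/(insertP (P := insert P y)) => // u' y' v' eq_uv lt_x'y' y'P _ _.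
have lt_yy' : y < y'.
  have : y' \in u ++ x :: v by rewrite eq_uv mem_cat mem_head orbT.
  move: row_lt row'_lt; rewrite !sorted_mid => /and4P[_ _ _ /allP y_lt].
  case/and4P=> _ _ /allP u_lt _.
  by rewrite mem_cat inE => /or3P[/u_lt|/eqP|/y_lt] /=; lia.
rewrite ltnS; apply: IHP => //.
case/andP: y'P => _ /= /andP[+ _]; apply: contra => y'P.
by have [_ /perm_mem ->] := insertable_insert yP; rewrite inE y'P orbT.
Qed.

(** After the first insertion [x] stands in the row, so the second letter bumps
    a letter that is at most [x], hence smaller than what [x] bumped. It
    therefore bumps something in every row that the first path reaches. *)
Lemma new_row_gtn P x x' : insertable P x -> x' \notin flatten P -> x' < x ->
  new_row P x < new_row (insert P x) x'.
Proof.
elim: P x x' => [|row P IHP] x x' xP x'P lt_x'x; first by rewrite /= lt_x'x.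
have x'xP : x' \notin x :: flatten (row :: P).
  by rewrite inE negb_or x'P andbT neq_ltn lt_x'x.
move: (insert_insertable xP x'xP) x'P.
case: (insertP xP) => [row_lt _ x'P _|u y v -> lt_xy yP row_lt row'_lt x'P'].
  case: (insertP x'P) => // /allP /(_ x).
  by rewrite mem_rcons mem_head => /(_ isT) /=; lia.
move=> _; move: x'P'; case/(insertP (P := insert P y)) => [/allP /(_ x)|].
  by rewrite mem_cat mem_head orbT /= => /(_ isT); lia.
move=> u' y' v' eq_uv lt_x'y' y'P row1_lt row2_lt.
have lt_y'y : y' < y.
  have : x \in u' ++ y' :: v' by rewrite -eq_uv mem_cat mem_head orbT.
  move: row1_lt row2_lt; rewrite !sorted_mid => /and4P[_ _ _ /allP y_lt].
  case/and4P=> _ _ /allP u_lt _.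
  by rewrite mem_cat inE => /or3P[/u_lt|/eqP|/y_lt] /=; lia.
rewrite ltnS; apply: IHP => //.
case/andP: y'P => _ /= /andP[+ _]; apply: contra => y'P.
by have [_ /perm_mem ->] := insertable_insert yP; rewrite inE y'P orbT.
Qed.

Lemma insert_neq0 P x : insert P x != [::].
Proof. by case: P => //= row P; case: ifP. Qed.

(** The bumped letter [y] tells where the bumping took place: [x] is the last
    letter of the new row that is smaller than [y]. *)
Lemma mid_inj (u v u' v' : seq nat) x x' y :
  sorted ltn (u ++ y :: v) -> x < y -> sorted ltn (u' ++ y :: v') -> x' < y ->
  u ++ x :: v = u' ++ x' :: v' -> [/\ u = u', x = x' & v = v'].
Proof.
rewrite !sorted_mid => /and4P[_ _ u_lt v_lt] lt_xy /and4P[_ _ u'_lt v'_lt] lt_x'y.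
elim: u u' u_lt u'_lt => [|z u IHu] [|z' u'] //=.
- by move=> _ _ [-> ->].
- move=> _ /andP[lt_z'y /allP u'_lt] [eq_xz' v_eq]; have := allP v_lt x'.
  by rewrite v_eq mem_cat mem_head orbT => /(_ isT) /=; lia.
- move=> /andP[lt_zy /allP u_lt] _ [eq_xz' v_eq]; have := allP v'_lt x.
  by rewrite -v_eq mem_cat mem_head orbT => /(_ isT) /=; lia.
by move=> /andP[_ u_lt] /andP[_ u'_lt] [-> /IHu[]// -> -> ->].
Qed.

(** The bumping path can be traced back upwards from the row of the new cell,
    each bumped letter locating the previous step by [mid_inj]. *)
Lemma insert_inj P x P' x' : insertable P x -> insertable P' x' ->
  [::] \notin P -> [::] \notin P' -> new_row P x = new_row P' x' ->
  insert P x = insert P' x' -> P = P' /\ x = x'.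
Proof.
elim: P x P' x' => [|row P IHP] x [|row' P'] x' xP x'P'.
- by move=> _ _ _ [->].
- move=> _; rewrite inE negb_or; case: (insertP x'P') => // _ _ /andP[row'0 _] _ /= [].
  by rewrite -[[:: x]]/(rcons [::] x) => /rcons_inj[eq_row']; rewrite -eq_row' in row'0.
- rewrite inE negb_or => /andP[row0 _] _; case: (insertP xP) => // _ _ _ /= [].
  by rewrite -[[:: x']]/(rcons [::] x') => /rcons_inj[eq_row]; rewrite eq_row in row0.
rewrite !inE !negb_or => /andP[row0 P0] /andP[row'0 P'0].
case: (insertP xP) => [_ _|u y v -> lt_xy yP row_lt _];
  case: (insertP x'P') => [_ _|u' y' v' -> lt_x'y' y'P' row'_lt _] //.
  by move=> _ [/rcons_inj[-> ->] ->].
move=> [/(IHP y P' y' yP y'P' P0 P'0) IH] [uv_eq] /IH [-> eq_yy'].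
move: lt_x'y' row'_lt; rewrite -eq_yy' => lt_x'y row'_lt.
by case: (mid_inj row_lt lt_xy row'_lt lt_x'y uv_eq) => -> -> ->.
Qed.

(** * Reverse insertion *)

(** Appending a letter and bumping one are both of the form
    [u ++ y :: behead w], where [w] is empty in the first case. *)
Lemma head_insert P y : insertable P y -> exists u w,
  [/\ head [::] P = u ++ w, head [::] (insert P y) = u ++ y :: behead w,
      all (gtn y) u & all (ltn y) w].
Proof.
case: P => [|row P] yP; first by exists [::], [::].
case: (insertP yP) => [row_lt _|u z v -> lt_yz _].
  by exists row, [::]; rewrite cats0 -cats1.
rewrite !sorted_mid => /and4P[_ _ _ v_lt] /and4P[_ _ u_lt v_lt'].
by exists u, (z :: v); rewrite /= lt_yz.
Qed.

Lemma above_mid_leq u y v x r :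
  x <= y -> above (u ++ y :: v) r -> above (u ++ x :: v) r.
Proof.
move=> le_xy; elim: u r => [|a u IHu] [|b r] //= /andP[lt_b]; last first.
  by rewrite lt_b => /IHu.
by move->; rewrite (leq_ltn_trans le_xy lt_b).
Qed.

Lemma above_mid_lt u x v y r :
  all (ltn y) r -> above (u ++ x :: v) r -> above (u ++ y :: v) r.
Proof.
elim: u r => [|a u IHu] [|b r] //= /andP[lt_yb r_gt] /andP[lt_b]; last first.
  by rewrite lt_b; apply: IHu.
by move->; rewrite lt_yb.
Qed.

Lemma above_contra v u y w :
  all (ltn y) v -> above v (u ++ y :: w) -> False.
Proof.
elim: u v => [|b u IHu] [|a v] //= /andP[lt_ya v_gt] /andP[lt_ab]; first lia.
exact: IHu.
Qed.

(** Columns stay increasing during an insertion because bumping paths move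
    weakly to the left: [y], which came from column [size u], lands in column
    [size u2], and the inequality between columns forces
    [size u2 <= size u]. *)
Lemma above_bump u y v x u2 w :
    x < y -> all (gtn y) u -> all (gtn y) u2 ->
  above (u ++ y :: v) (u2 ++ w) -> above (u ++ x :: v) (u2 ++ y :: behead w).
Proof.
move=> lt_xy; elim: u u2 => [|a u IHu] [|b u2] /=.
- by move=> _ _; rewrite lt_xy; case: w => //= [_|z w /andP[_ ->]//]; case: v.
- by move=> _ /andP[lt_by _] /andP[]; lia.
- move=> /andP[lt_ay _] _; rewrite lt_ay /=; case: (w) => [|z w3] /=.
    by move=> _; case: (u ++ _).
  by case/andP=> _; apply/above_mid_leq/ltnW.
by move=> /andP[_ u_lt] /andP[_ u2_lt] /andP[-> /IHu]; apply.
Qed.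

(** The converse of [above_bump], for a letter [y] that moves back up: it lands
    in the column of [x], the last letter smaller than [y], which lies weakly to
    the right of the column that [y] leaves. *)
Lemma above_unbump u y v x u2 w :
    x < y -> all (ltn y) v -> all (ltn y) w -> all (gtn y) u ->
  above (u ++ x :: v) (u2 ++ y :: behead w) -> above (u ++ y :: v) (u2 ++ w).
Proof.
move=> lt_xy v_gt w_gt; elim: u u2 => [|a u IHu] [|b u2] /=.
- by move=> _; case: w w_gt => //= z w /andP[-> _] /andP[_ ->].
- by move=> _ /andP[_ /(above_contra v_gt)].
- case: w w_gt {IHu} => //= z w /andP[lt_yz w_gt] /andP[lt_ay u_lt] /andP[_].
  by move/(above_mid_lt w_gt) ->; rewrite (ltn_trans lt_ay lt_yz).
by move=> /andP[_ u_lt] /andP[-> /IHu]; apply.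
Qed.

Lemma above_rcons u x v : above u v -> above (rcons u x) v.
Proof. by elim: u v => [|a u IHu] [|b v] //= /andP[-> /IHu]. Qed.

Lemma above_rconsl u x v :
  size v <= size u -> above (rcons u x) v -> above u v.
Proof. by elim: u v => [|a u IHu] [|b v] //= /IHu IH /andP[-> /IH]. Qed.

Lemma above_rconsr u v x : above u (rcons v x) -> above u v.
Proof. by elim: u v => [|a u IHu] [|b v] //= /andP[-> /IHu]. Qed.

Lemma tableau_insert P x :
  tableau ltn P -> insertable P x -> tableau ltn (insert P x).
Proof.
elim: P x => [|row P IHP] x //; rewrite tableau_cons => /and4P[row0 row_lt abv Ptab] xP.
case: (insertP xP) => [_ row'_lt|u y v row_eq lt_xy yP row1_lt row2_lt];
  rewrite tableau_cons.
  by rewrite Ptab row'_lt above_rcons // -size_eq0 size_rcons.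
rewrite IHP // row2_lt -size_eq0 size_cat addnS /= andbT.
have [u2 [w [P_head -> u2_lt _]]] := head_insert yP.
by move: row1_lt; rewrite sorted_mid => /and4P[_ _ u_lt _];
  apply: above_bump; rewrite // -P_head -row_eq.
Qed.

Fixpoint add_cell (T : filling) (i a : nat) : filling :=
  match T, i with
  | [::], _ => [:: [:: a]]
  | row :: T', 0 => rcons row a :: T'
  | row :: T', i'.+1 => row :: add_cell T' i' a
  end.

(** Missing rows are read as empty rows, so the end of the last row is a
    corner. *)
Definition corner (P : filling) (i : nat) : bool :=
  size (nth [::] P i.+1) < size (nth [::] P i).

Lemma sorted_rcons_l (A : Type) (e : rel A) u x : sorted e (rcons u x) -> sorted e u.
Proof. by case: u => //= a u; rewrite rcons_path => /andP[]. Qed.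

Lemma add_cell_surj e T i : tableau e T -> corner T i ->
  exists T0 a, [/\ T = add_cell T0 i a, tableau e T0 & i <= size T0].
Proof.
elim: T i => [|row T IHT] i; first by rewrite /corner !nth_nil.
rewrite tableau_cons => /and4P[row0 row_e abv Ttab].
case: i => [|i] cornerT.
  case: (lastP row) row0 row_e abv cornerT => // row' a _ row_e abv.
  rewrite /corner /= size_rcons ltnS nth0 => size_le.
  case: row' row_e abv size_le => [|b row'] row_e abv size_le.
    case: T {IHT} Ttab size_le {abv} => [|[|//] T]; first by exists [::], a.
    by rewrite tableau_cons.
  exists ((b :: row') :: T), a; split=> //.
  by rewrite tableau_cons Ttab (above_rconsl size_le abv) (sorted_rcons_l row_e).
have [T0 [a [T_eq T0tab le_i]]] := IHT i Ttab cornerT.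
exists (row :: T0), a; rewrite T_eq tableau_cons T0tab row0 row_e !andbT; split=> //=.
move: abv; rewrite T_eq; case: (T0) => [|r T1]; first by case: (row).
by case: (i) => //= /above_rconsr.
Qed.

Lemma insert_mid u y v P x : all (gtn x) u -> x < y ->
  insert ((u ++ y :: v) :: P) x = (u ++ x :: v) :: insert P y /\
  new_row ((u ++ y :: v) :: P) x = (new_row P y).+1.
Proof.
move=> u_lt lt_xy /=.
have -> : find [eta leq x.+1] (u ++ y :: v) = size u.
  rewrite find_cat /= lt_xy addn0; case: ifP => // /hasP[z /(allP u_lt) /=]; lia.
rewrite nth_cat ltnn subnn size_cat addnS ltnS leq_addr set_nthE size_cat addnS ltnS.
rewrite leq_addr take_size_cat // drop_cat /= ltnNge leqnSn /= subSn // subnn.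
by rewrite drop1.
Qed.

(** Reverse insertion starting from a corner cell. The letter [y] removed from
    the lower rows replaces, in the row above, the last letter [x] that is
    smaller than [y]; there is such a letter because the column of [y]
    increases. *)
Lemma insert_surj P i :
    tableau ltn P -> uniq (flatten P) -> corner P i -> exists P0 x,
  [/\ tableau ltn P0, insertable P0 x, insert P0 x = P & new_row P0 x = i].
Proof.
elim: i P => [|i IHi] P Ptab Puniq cornerP.
  have [P0 [x [P_eq P0tab _]]] := add_cell_surj Ptab cornerP; exists P0, x.
  have xP : insertable P0 x.
    rewrite /insertable; case/and3P: P0tab => _ -> _; rewrite andTb.
    move: Puniq; rewrite P_eq; case: (P0) => //= row P'.
    by rewrite cat_rcons -cat1s uniq_catCA.
  rewrite P_eq; split=> //; move: Ptab xP; rewrite P_eq; case: (P0) => [|row P'] //;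
    rewrite [add_cell _ _ _]/= tableau_cons => /and4P[_ row_lt _ _] xP;
    case: (insertP xP) => // u y v row_eq lt_xy;
    move: row_lt; rewrite row_eq -cats1 sorted_mid all_cat => /and4P[_ _];
    move=> /andP[_ /= /andP[lt_yx _]] _; lia.
case: P Ptab Puniq cornerP => [|row P] //=.
rewrite tableau_cons cat_uniq => /and4P[row0 row_lt abv Ptab].
case/and3P=> row_uniq /hasPn rowP Puniq cornerP.
have {IHi} [P0 [y [P0tab yP insert_y row_y]]] := IHi P Ptab Puniq cornerP.
have yrow : y \notin row.
  apply: rowP; rewrite -insert_y.
  by have [_ /perm_mem ->] := insertable_insert yP; apply: mem_head.
have [u2 [w [P0_head P_head u2_lt w_gt]]] := head_insert yP.
rewrite insert_y in P_head.
(* x is the last letter of the row that is smaller than y *)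
have [u [x [v [row_eq lt_xy v_gt]]]] :
    exists u x v, [/\ row = u ++ x :: v, x < y & all (ltn y) v].
  have : has (gtn y) row.
    apply/negPn/negP; rewrite -all_predC => row_gt.
    apply: (@above_contra row u2 y (behead w)); rewrite -?P_head //.
    apply/allP => z z_row; rewrite /= ltn_neqAle leqNgt; have /= -> := allP row_gt z z_row.
    by rewrite andbT; apply: contraNneq yrow => ->.
  elim: (row) yrow => //= a r IHr; rewrite inE negb_or => /andP[neq_ya yr].
  have [has_r _|/= no_r] := boolP (has (gtn y) r).
    by have [u [x [v [-> lt_xy v_gt]]]] := IHr yr has_r; exists (a :: u), x, v.
  rewrite orbF => lt_ay; exists [::], a, r; split=> //.
  move: no_r; rewrite -all_predC => no_r.
  apply/allP => z z_r; rewrite /= ltn_neqAle leqNgt; have /= -> := allP no_r z z_r.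
  by rewrite andbT; apply: contraNneq yr => ->.
have := row_lt; rewrite row_eq sorted_mid => /and4P[u_sort v_sort u_lt _].
have row0_lt : sorted ltn (u ++ y :: v).
  rewrite sorted_mid u_sort v_sort v_gt andbT.
  by apply: sub_all u_lt => z /= lt_zx; apply: ltn_trans lt_xy.
have xP : insertable ((u ++ y :: v) :: P0) x.
  apply/andP; split; first by rewrite /= row0_lt; case/and3P: P0tab.
  move: row_uniq rowP; rewrite row_eq => row_uniq rowP.
  have: uniq ((u ++ x :: v) ++ flatten P).
    by rewrite cat_uniq row_uniq Puniq andbT; apply/hasPn.
  have [_ perm_P] := insertable_insert yP; rewrite insert_y in perm_P.
  by rewrite (perm_uniq (perm_mid u v x perm_P)).
exists ((u ++ y :: v) :: P0), x.
have tabP0 : tableau ltn ((u ++ y :: v) :: P0).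
  rewrite tableau_cons P0tab row0_lt -size_eq0 size_cat addnS /= andbT.
  rewrite P0_head; apply: (above_unbump lt_xy) => //.
    by move: row0_lt; rewrite sorted_mid => /and4P[].
  by rewrite -row_eq -P_head.
have [insert_x row_x] := insert_mid v P0 u_lt lt_xy.
by split; rewrite // ?insert_x ?row_x ?row_y // insert_y.
Qed.

(** * Adding a cell to a recording tableau *)

Lemma add_cell_neq0 T i a : add_cell T i a != [::].
Proof. by case: T i => [|row T] []. Qed.

Lemma shape_add_cell T T' i a a' :
  shape T = shape T' -> shape (add_cell T i a) = shape (add_cell T' i a').
Proof.
elim: T T' i => [|row T IHT] [|row' T'] //= i [size_row] shape_T.
by case: i => [|i] /=; rewrite ?size_rcons ?size_row ?shape_T // (IHT T').
Qed.

Lemma shape_insert P x a : shape (insert P x) = shape (add_cell P (new_row P x) a).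
Proof.
elim: P x => //= row P IHP x; case: ifP => /= [lt_k|_]; last by rewrite !size_rcons.
by rewrite IHP size_set_nth (maxn_idPr lt_k).
Qed.

Lemma new_row_leq P x : new_row P x <= size P.
Proof. by elim: P x => //= row P IHP x; case: ifP => //; rewrite ltnS. Qed.

Lemma perm_add_cell T i a : perm_eq (flatten (add_cell T i a)) (a :: flatten T).
Proof.
elim: T i => //= row T IHT [|i]; apply/seq.permP => p /=.
  by rewrite cat_rcons !count_cat /=; lia.
by rewrite !count_cat; move/seq.permP: (IHT i) => -> /=; lia.
Qed.

Lemma take_add_cell T i a : i <= size T -> take i (add_cell T i a) = take i T.
Proof. by elim: T i => [|row T IHT] [|i] //=; rewrite ltnS => /IHT ->. Qed.

Lemma nth_add_cell T i a : i <= size T ->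
  nth [::] (add_cell T i a) i = rcons (nth [::] T i) a.
Proof. by elim: T i => [|row T IHT] [|i] //=; rewrite ltnS => /IHT ->. Qed.

Lemma nth_add_cell_lt T i a j : i <= size T -> j < i ->
  nth [::] (add_cell T i a) j = nth [::] T j.
Proof. by elim: T i j => [|row T IHT] [|i] [|j] //=; rewrite !ltnS => /IHT IH /IH. Qed.

Lemma add_cell_inj T T' i a : [::] \notin T -> [::] \notin T' ->
  add_cell T i a = add_cell T' i a -> T = T'.
Proof.
have nil_rcons (row : seq nat) : [:: a] = rcons row a -> row = [::].
  by move/(@rcons_inj _ [::] row a a) => [].
elim: T T' i => [|row T IHT] [|row' T'] i //; rewrite ?inE ?negb_or.
- move=> _ /andP[row'0 _]; case: i => [|i] /= [].
    by move/nil_rcons=> row'_eq; rewrite row'_eq in row'0.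
  by move=> _ /esym /eqP; rewrite (negPf (add_cell_neq0 _ _ _)).
- move=> /andP[row0 _] _; case: i => [|i] /= [].
    by move/esym/nil_rcons=> row_eq; rewrite row_eq in row0.
  by move=> _ /eqP; rewrite (negPf (add_cell_neq0 _ _ _)).
move=> /andP[_ T0] /andP[_ T'0]; case: i => [|i] /= [].
  by move=> /rcons_inj[-> ->].
by move=> -> /IHT ->.
Qed.

Lemma shape_add_cell_inj T T' i a a' : [::] \notin T -> [::] \notin T' ->
  shape (add_cell T i a) = shape (add_cell T' i a') -> shape T = shape T'.
Proof.
elim: T T' i => [|row T IHT] [|row' T'] i //; rewrite ?inE ?negb_or.
- move=> _ /andP[row'0 _]; case: i => [|i] /= [].
    by rewrite size_rcons => /esym /(congr1 predn) /= /size0nil row'_eq; rewrite row'_eq in row'0.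
  by move=> _ /(congr1 size); rewrite size_map; case: (add_cell _ _ _) (add_cell_neq0 T' i a').
- move=> /andP[row0 _] _; case: i => [|i] /= [].
    by rewrite size_rcons => /(congr1 predn) /= /size0nil row_eq; rewrite row_eq in row0.
  by move=> _ /(congr1 size); rewrite size_map; case: (add_cell _ _ _) (add_cell_neq0 T i a).
move=> /andP[_ T0] /andP[_ T'0]; case: i => [|i] /= [].
  by rewrite !size_rcons => /(congr1 predn) /= -> ->.
by move=> -> /IHT ->.
Qed.

(** For a semistandard tableau whose row [i] ends in [a], this says that the end
    of row [i] is the rightmost of the cells with the largest entry: equal
    entries form a horizontal strip, in which further right means further up. *)
Definition dominates_before (T : filling) (i a : nat) : bool :=
  all (geq a) (flatten T) && all (gtn a) (flatten (take i T)).

Lemma sorted_geq_tableau e P : tableau e P -> sorted geq (shape P).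
Proof.
case/and3P=> _ _; rewrite sorted_map; case: P => //= row P.
by apply: sub_path => u v /aboveP[].
Qed.

Lemma above_all_lt u v a : size v < size u -> above u v -> all (gtn a) u ->
  above u (rcons v a).
Proof.
elim: u v => [|b u IHu] [|c v] //= lt_vu.
  by move=> _ /andP[-> _]; case: (u).
by move=> /andP[-> abv] /andP[_ u_lt]; apply: IHu.
Qed.

(** Only the column condition above the new cell needs an argument: the row
    above consists of entries smaller than [a]. *)
Lemma tableau_add_cell T i a :
    tableau leq T -> i <= size T -> sorted geq (shape (add_cell T i a)) ->
  dominates_before T i a -> tableau leq (add_cell T i a).
Proof.
move=> + + + /andP[].
elim: T i => [|row T IHT] i; first by rewrite tableau_cons.
rewrite tableau_cons /= all_cat.
move=> /and4P[row0 row_leq abv Ttab] + + /andP[row_le T_le].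
case: i => [|i] /=.
  move=> _ _ _; rewrite tableau_cons Ttab above_rcons // -size_eq0 size_rcons /= andbT.
  rewrite -cats1; case: (row) row_leq row_le => //= b r; rewrite cat_path /= andbT => -> /= le_r.
  by have := (@allP _ (geq a) (b :: r)) le_r (last b r) (mem_last b r) => /= ->.
rewrite ltnS all_cat => le_i shape_geq /andP[row_lt T_lt].
rewrite tableau_cons row0 row_leq /= (IHT i) //; last by apply: path_sorted shape_geq.
rewrite andbT; case: T abv i {IHT Ttab T_le T_lt le_i} shape_geq => [|r T] abv i.
  by move=> _; case: (row) row0 row_lt => //= b r _ /andP[-> _]; case: r.
case: i => //= /andP[+ _]; rewrite size_rcons => size_lt.
exact: above_all_lt.
Qed.

(** * The Robinson-Schensted-Knuth correspondence *)

Definition rsk_step (PT : filling * filling) (xa : nat * nat) :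
    filling * filling :=
  (insert PT.1 xa.1, add_cell PT.2 (new_row PT.1 xa.1) xa.2).

Definition rsk : seq (nat * nat) -> filling * filling :=
  foldl rsk_step ([::], [::]).

Lemma rsk_rcons bw xa : rsk (rcons bw xa) = rsk_step (rsk bw) xa.
Proof. by rewrite /rsk foldl_rcons. Qed.

(** In an array sorted strictly by this order, equal recorded letters come with
    increasing inserted letters, so that their cells form a horizontal strip. *)
Definition biletter_lt (p q : nat * nat) : bool :=
  (p.2 < q.2) || (p.2 == q.2) && (p.1 < q.1).

Definition biword (bw : seq (nat * nat)) : bool :=
  sorted biletter_lt bw && uniq (unzip1 bw).

Lemma biword_rcons_prev bw xa : biword (rcons bw xa) -> biword bw.
Proof.
rewrite /biword /unzip1 map_rcons rcons_uniq.
by case/andP=> bw_sorted /andP[_ ->]; rewrite andbT (sorted_rcons_l bw_sorted).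
Qed.

(** For two successive biletters with the same recorded letter the inserted
    letters increase, so by [new_row_ltn] the second cell lies weakly above the
    first one. This is what keeps the second tableau semistandard and makes the
    last cell the topmost one with a largest entry. *)
Lemma rsk_spec bw (P := (rsk bw).1) (T := (rsk bw).2) : biword bw ->
  [/\ tableau ltn P, perm_eq (flatten P) (unzip1 bw),
      tableau leq T, perm_eq (flatten T) (unzip2 bw) & shape T = shape P] /\
  forall bw0 xa, bw = rcons bw0 xa -> insertable (rsk bw0).1 xa.1 /\
    dominates_before T (new_row (rsk bw0).1 xa.1) xa.2.
Proof.
rewrite {}/P {}/T; elim/last_ind: bw => [|bw [x a] IHbw] bw_ok.
  by split=> // -[].
have [[Ptab P_perm Ttab T_perm shapeT] dom_bw] := IHbw (biword_rcons_prev bw_ok).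
rewrite rsk_rcons /=; set P := (rsk bw).1 in Ptab P_perm shapeT dom_bw *.
set T := (rsk bw).2 in Ttab T_perm shapeT dom_bw *.
have xP : insertable P x.
  case/and3P: (Ptab) => _ P_lt _; rewrite /insertable P_lt /=.
  move: bw_ok => /andP[_]; rewrite /unzip1 map_rcons rcons_uniq.
  by rewrite (perm_mem P_perm) (perm_uniq P_perm).
have le_row : new_row P x <= size T.
  by rewrite -(size_map size) -/(shape T) shapeT size_map new_row_leq.
have dom_T : dominates_before T (new_row P x) a.
  have [bw_nil|[bw1 [[x1 a1] bw_eq]]] :
      bw = [::] \/ exists bw1 xa, bw = rcons bw1 xa.
    by case: (lastP bw) => [|bw1 xa]; [left | right; exists bw1, xa].
    by rewrite /T bw_nil.
  have [x1P /andP[/= T_le T_lt]] := dom_bw _ _ bw_eq.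
  move: bw_ok xP; rewrite /P bw_eq rsk_rcons /= => /andP[+ bw_uniq] xP.
  set P1 := (rsk bw1).1 in x1P T_lt xP *.
  rewrite -cats1 cat_rcons sorted_cat_cons => /andP[_].
  rewrite /= andbT /biletter_lt /= => /orP[lt_a1|/andP[/eqP eq_a lt_x]].
    have T_lt' : all (gtn a) (flatten T).
      by apply: sub_all T_le => y /= le_y; apply: leq_ltn_trans lt_a1.
    apply/andP; split; first by apply: sub_all T_lt' => y; apply: ltnW.
    apply/allP => y y_in; apply: (allP T_lt').
    by rewrite -(cat_take_drop (new_row (insert P1 x1) x) T) flatten_cat mem_cat y_in.
  rewrite -eq_a; apply/andP; split=> //.
  (* equal recorded letters: the new cell is weakly above the previous one *)
  have le_i : new_row (insert P1 x1) x <= new_row P1 x1.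
    apply: new_row_ltn => //; case/andP: xP => _ /= /andP[+ _]; apply: contra.
    by have [_ /perm_mem ->] := insertable_insert x1P; rewrite inE orbC => ->.
  apply/allP => y /flattenP[row row_in y_row]; apply: (allP T_lt); apply/flattenP.
  by exists row => //; rewrite -(subnKC le_i) takeD mem_cat row_in.

have shapeT' : shape (add_cell T (new_row P x) a) = shape (insert P x).
  by rewrite (shape_insert _ _ a); apply: shape_add_cell.
split; last first.
  move=> bw0 xa /rcons_inj[<- <-]; split=> //=; rewrite -/P -/T.
  case/andP: dom_T => T_le T_lt; rewrite /dominates_before take_add_cell // T_lt andbT.
  by rewrite (perm_all _ (perm_add_cell _ _ _)) /= leqnn.
split=> //.
- exact: tableau_insert.
- have [_ /perm_trans -> //] := insertable_insert xP.
  by rewrite /unzip1 map_rcons perm_sym perm_rcons perm_cons perm_sym.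
- apply: tableau_add_cell => //; rewrite shapeT'.
  by apply: sorted_geq_tableau; apply: tableau_insert.
rewrite (perm_trans (perm_add_cell _ _ _)) //.
by rewrite /unzip2 map_rcons perm_sym perm_rcons perm_cons perm_sym.
Qed.

Lemma mem_flatten_add_cell T i a b :
  (b \in flatten (add_cell T i a)) = (b == a) || (b \in flatten T).
Proof. by rewrite (perm_mem (perm_add_cell T i a)) inE. Qed.

(** The last cell added by the correspondence can be recognised in the
    recording tableau. *)
Lemma dominates_before_inj T i a i' a' :
    dominates_before T i a -> dominates_before T i' a' ->
    a \in nth [::] T i -> a' \in nth [::] T i' -> i = i' /\ a = a'.
Proof.
have in_flat (b : nat) j : b \in nth [::] T j -> b \in flatten T.
  move=> b_in; apply/flattenP; exists (nth [::] T j) => //; apply: mem_nth.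
  by rewrite ltnNge; apply/negP => le_T; rewrite nth_default in b_in.
move=> /andP[T_le T_lt] /andP[T_le' T_lt'] a_in a'_in.
have eq_a : a = a'.
  have := allP T_le _ (in_flat _ _ a'_in); have := allP T_le' _ (in_flat _ _ a_in).
  by move=> /= le_aa' le_a'a; apply/eqP; rewrite eqn_leq le_aa'.
have no_lt j k b : all (gtn b) (flatten (take k T)) -> b \in nth [::] T j -> k <= j.
  move=> /allP T_ltb b_in; rewrite leqNgt; apply/negP => lt_jk.
  suff b_flat : b \in flatten (take k T) by have := T_ltb _ b_flat; rewrite /= ltnn.
  apply/flattenP; exists (nth [::] T j) => //; rewrite -(nth_take _ lt_jk).
  apply: mem_nth; rewrite size_take; case: ifP => // _.
  by rewrite ltnNge; apply/negP => le_T; rewrite nth_default in b_in.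
split=> //; apply/eqP; rewrite eqn_leq (no_lt _ _ _ T_lt) ?eq_a //.
by rewrite (no_lt _ _ _ T_lt') // -eq_a.
Qed.

(** The recording tableau determines the last cell added; removing it and
    undoing the insertion gives back the two previous tableaux. *)
Lemma rsk_inj bw bw' : biword bw -> biword bw' -> rsk bw = rsk bw' -> bw = bw'.
Proof.
elim/last_ind: bw bw' => [|bw [x a] IHbw] bw'; case/lastP: bw' => [|bw' [x' a']] //.
- by rewrite rsk_rcons => _ _ [] /esym /eqP; rewrite (negPf (insert_neq0 _ _)).
- by rewrite rsk_rcons => _ _ [] /eqP; rewrite (negPf (insert_neq0 _ _)).
move=> bw_ok bw'_ok.
have [[Ptab _ Ttab _ shapeT] _] := rsk_spec (biword_rcons_prev bw_ok).
have [[P'tab _ T'tab _ shapeT'] _] := rsk_spec (biword_rcons_prev bw'_ok).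
have [_ /(_ _ _ erefl)[/= xP domT]] := rsk_spec bw_ok.
have [_ /(_ _ _ erefl)[/= x'P' domT']] := rsk_spec bw'_ok.
move=> eq_rsk; move: (eq_rsk) domT domT'; rewrite -eq_rsk rsk_rcons => eq_rsk'.
rewrite /rsk_step /=.
have [eqP eqT] : insert (rsk bw).1 x = insert (rsk bw').1 x' /\
   add_cell (rsk bw).2 (new_row (rsk bw).1 x) a =
   add_cell (rsk bw').2 (new_row (rsk bw').1 x') a'.
  by move: eq_rsk; rewrite !rsk_rcons => -[-> ->].
have le_row bw0 y : shape (rsk bw0).2 = shape (rsk bw0).1 ->
    new_row (rsk bw0).1 y <= size (rsk bw0).2.
  by move=> sh; rewrite -(size_map size) -/(shape _) sh size_map new_row_leq.
move=> domT domT'.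
have [||eq_row eq_a] := dominates_before_inj domT domT'.
- by rewrite nth_add_cell ?le_row // mem_rcons mem_head.
- by rewrite eqT nth_add_cell ?le_row // mem_rcons mem_head.
have no_nil e U : tableau e U -> [::] \notin U by case/and3P.
have [eqP0 eq_x] := insert_inj xP x'P' (no_nil _ _ Ptab) (no_nil _ _ P'tab) eq_row eqP.
have eqT0 : (rsk bw).2 = (rsk bw').2.
  apply: (@add_cell_inj _ _ (new_row (rsk bw).1 x) a); rewrite ?(no_nil leq) //.
  by rewrite eqT -eq_row eq_a.
rewrite eq_x eq_a (IHbw bw') ?(biword_rcons_prev bw_ok) ?(biword_rcons_prev bw'_ok) //.
by rewrite [LHS]surjective_pairing eqP0 eqT0 -surjective_pairing.
Qed.

Lemma ex_max_letter (s : seq nat) :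
  s != [::] -> exists2 a, a \in s & all (geq a) s.
Proof.
elim: s => // b s IHs _; case: (eqVneq s [::]) => [->|/IHs[a a_s s_le]].
  by exists b; rewrite ?mem_head //= leqnn.
case: (leqP a b) => [le_ab|lt_ba].
  exists b; first exact: mem_head.
  by rewrite /= leqnn; apply: sub_all s_le => c /= /leq_trans; apply.
by exists a; rewrite ?inE ?a_s ?orbT //= ltnW.
Qed.

Lemma corner_shape T P i : shape T = shape P -> corner T i = corner P i.
Proof.
have size_nth U j : size (nth [::] U j) = nth 0 (shape U) j.
  by elim: U j => [|row U IHU] [|j] //=.
by move=> eq_sh; rewrite /corner !size_nth eq_sh.
Qed.

Lemma tableau_nth_above e T i : tableau e T -> i.+1 < size T ->
  above (nth [::] T i) (nth [::] T i.+1).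
Proof. by case/and3P=> _ _ /(sortedP [::]) abv; apply: abv. Qed.

(** A cell below the last cell of this row would carry an entry larger than the
    maximum. *)
Lemma corner_topmost_max T a :
    tableau leq T -> a \in flatten T -> all (geq a) (flatten T) ->
  corner T (find (fun row => a \in row) T).
Proof.
move=> Ttab /flattenP[row row_in a_row] /allP T_le; set i := find _ T.
have has_a : has (fun row : seq nat => a \in row) T by apply/hasP; exists row.
have a_i : a \in nth [::] T i by apply: (nth_find [::] has_a).
rewrite /corner; have [le_T|lt_T] := leqP (size T) i.+1.
  by rewrite (nth_default _ le_T); case: (nth _ _ _) a_i.
rewrite ltnNge; apply/negP => le_size.
have /aboveP[_ /(_ (index a (nth [::] T i)))] := tableau_nth_above Ttab lt_T.
rewrite (leq_trans _ le_size) ?index_mem // nth_index // => /(_ isT).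
apply/negP; rewrite -leqNgt; apply: T_le; apply/flattenP.
exists (nth [::] T i.+1); rewrite mem_nth // (leq_trans _ le_size) //.
by rewrite index_mem.
Qed.

(** Peel off the topmost cell with a largest entry and undo the corresponding
    insertion. If the previous biletter recorded the same letter, its cell is
    not above the removed one, so by [new_row_gtn] the inserted letters
    increase. *)
Lemma rsk_surj P T : tableau ltn P -> uniq (flatten P) -> tableau leq T ->
  shape T = shape P -> exists2 bw, biword bw & rsk bw = (P, T).
Proof.
have [n] := ubnP (size (flatten T)); elim: n P T => // n IHn P T.
rewrite ltnS => le_n Ptab Puniq Ttab shapeT.
case: (eqVneq (flatten T) [::]) => [T0|/ex_max_letter[a a_T T_le]].
  have nil_tab U e : tableau e U -> flatten U = [::] -> U = [::].
    by case: U => // row U; rewrite tableau_cons => /andP[]; case: row.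
  exists [::] => //; have T_nil := nil_tab _ _ Ttab T0.
  by move: shapeT; rewrite T_nil; case: (P).
have cornerT := corner_topmost_max Ttab a_T T_le.
set i := find _ T in cornerT.
have a_i : a \in nth [::] T i.
  have /flattenP[row row_in a_row] := a_T.
  by apply: (@nth_find _ [::] (fun row => a \in row)); apply/hasP; exists row.
have [T0 [a0 [T_eq T0tab le_i]]] := add_cell_surj Ttab cornerT.
have eq_a0 : a0 = a.
  apply/eqP; rewrite eqn_leq; have -> /= : a0 <= a.
    by apply: (allP T_le); rewrite T_eq mem_flatten_add_cell eqxx.
  have : sorted leq (nth [::] T i).
    case/and3P: Ttab => _ /all_nthP T_leq _; apply: T_leq.
    by rewrite ltnNge; apply/negP => le_T; rewrite nth_default in a_i.
  move: a_i; rewrite T_eq nth_add_cell // mem_rcons inE => /predU1P[->//|a_in].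
  rewrite -cats1 (sorted_pairwise leq_trans) pairwise_cat allrelC allrel1l.
  by case/andP=> /allP /(_ a a_in).
rewrite {a0}eq_a0 in T_eq.
have := insert_surj Ptab Puniq; move/(_ i); rewrite -(corner_shape _ shapeT).
case/(_ cornerT)=> P0 [x [P0tab xP insert_x row_x]].
have no_nil e U : tableau e U -> [::] \notin U by case/and3P.
have shapeT0 : shape T0 = shape P0.
  apply: (@shape_add_cell_inj _ _ i a 0); rewrite ?(no_nil _ _ P0tab) ?(no_nil _ _ T0tab) //.
  by rewrite -T_eq shapeT -insert_x (shape_insert _ _ 0) row_x.
have [|||||bw bw_ok rsk_bw] := IHn P0 T0.
- move: le_n; rewrite T_eq; have /perm_size -> := perm_add_cell T0 i a; exact.
- by [].
- by case/andP: xP => _ /= /andP[].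
- by [].
- by [].
exists (rcons bw (x, a)); last by rewrite rsk_rcons rsk_bw /rsk_step /= row_x insert_x -T_eq.
have [[_ P0_perm _ T0_perm _] bw_dom] := rsk_spec bw_ok.
rewrite rsk_bw /= in P0_perm T0_perm bw_dom.
case/andP: (bw_ok) => bw_sorted bw_uniq.
apply/andP; split; last first.
  rewrite /unzip1 map_rcons rcons_uniq -/(unzip1 bw) bw_uniq andbT.
  by rewrite -(perm_mem P0_perm); case/andP: xP => _ /= /andP[].
case: (lastP bw) bw_ok bw_sorted rsk_bw T0_perm bw_dom => // bw1 [x1 a1] bw_ok bw_sorted.
rewrite rsk_rcons /rsk_step /= => -[P0_eq T0_eq] T0_perm.
move=> /(_ _ _ erefl)[/= x1P dom].
rewrite -cats1 cat_rcons sorted_cat_cons bw_sorted /= andbT /biletter_lt /=.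
have : a1 <= a.
  apply: (allP T_le); rewrite T_eq mem_flatten_add_cell (perm_mem T0_perm).
  by rewrite /unzip2 map_rcons mem_rcons mem_head orbT.
rewrite leq_eqVlt => /orP[/eqP eq_a1|->] //; rewrite eq_a1 eqxx ltnn /= ltnNge leq_eqVlt.
have [x_P1 neq_x] : x \notin flatten (rsk bw1).1 /\ x != x1.
  move: xP; rewrite -P0_eq => /andP[_ /= /andP[+ _]].
  have [_ /perm_mem ->] := insertable_insert x1P.
  by rewrite inE negb_or => /andP[].
(* a descent here would put the previous cell strictly above row i, against
   the choice of i *)
rewrite (negPf neq_x) /=; apply/negP => /(new_row_gtn x1P x_P1).
rewrite P0_eq row_x => lt_i.
have := before_find [::] lt_i; rewrite T_eq nth_add_cell_lt // -T0_eq eq_a1.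
rewrite nth_add_cell ?mem_rcons ?mem_head //.
have [[_ _ _ _ sh1] _] := rsk_spec (biword_rcons_prev bw_ok).
by rewrite -(size_map size) -/(shape _) sh1 size_map new_row_leq.
Qed.

(** * Peaks and Knuth moves *)

(** The order [e] is a parameter because reversing it exchanges the roles of
    the two subsequences ([peak_conv]); each kind of Knuth move then has to be
    studied in one direction only. *)
Definition peak (e : rel nat) (r s : nat) (w : seq nat) : Prop :=
  exists U V, [/\ subseq U w /\ subseq V w, sorted e U,
    sorted (fun x y => e y x) V, r <= size U /\ s <= size V &
    last 0 U = last 0 V].

Lemma peak_conv r s w : peak ltn r s w <-> peak gtn s r w.
Proof.
by split=> -[U [V [[subU subV] Ulst Vlst [le_r le_s] eq_last]]]; exists V, U; split.
Qed.

Lemma subseq_catP (A : eqType) (U l m : seq A) : subseq U (l ++ m) ->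
  exists U1 U2, [/\ U = U1 ++ U2, subseq U1 l & subseq U2 m].
Proof.
case/subseqP=> msk size_msk ->; rewrite size_cat in size_msk.
exists (mask (take (size l) msk) l), (mask (drop (size l) msk) m).
rewrite -mask_cat ?cat_take_drop ?mask_subseq //.
by rewrite size_takel // size_msk leq_addr.
Qed.

(** A subsequence is affected by the exchange of two adjacent letters only when
    it uses both of them. *)
Lemma subseq_swap (A : eqType) (U l m : seq A) a c : subseq U (l ++ a :: c :: m) ->
  subseq U (l ++ c :: a :: m) \/
  exists U1 U3, [/\ U = U1 ++ a :: c :: U3, subseq U1 l & subseq U3 m].
Proof.
rewrite -[a :: _]/([:: a; c] ++ m) => /subseq_catP[U1 [W [-> sub1]]].
case/subseq_catP=> U2 [U3 [-> sub2 sub3]].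
have [ac_U2|] := boolP (U2 == [:: a; c]).
  by right; exists U1, U3; rewrite (eqP ac_U2).
move=> U2_neq; left; apply: cat_subseq => //.
rewrite -[c :: _]/([:: c; a] ++ m); apply: cat_subseq => //.
move: U2_neq; case/subseqP: sub2 => -[|b1 [|b2 [|b3 msk]]] //= _ ->.
by case: b1; case: b2 => /=; rewrite ?eqxx // => _; case: (a == c); rewrite ?eqxx.
Qed.

Lemma subseq_rcons_notin (A : eqType) (U l : seq A) b :
  b \notin U -> subseq U (rcons l b) -> subseq U l.
Proof.
move=> bU; rewrite -cats1 => /subseq_catP[U1 [U2 [U_eq sub1 sub2]]].
case: U2 U_eq sub2 => [|b' U2] U_eq; first by rewrite U_eq cats0.
rewrite U_eq mem_cat inE in bU.
move: bU; rewrite eq_sym /=; case: (b' == b) => //; by rewrite orbT.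
Qed.

Lemma sorted_conv_mid (A : eqType) (e : rel A) u x v : transitive e ->
  sorted (fun y z => e z y) (u ++ x :: v) ->
  all (e x) u /\ all (e^~ x) v.
Proof.
move=> e_tr; rewrite sorted_mid_trans; first by case/and4P.
by move=> y x' z /= lt_yx' lt_zy; apply: e_tr lt_yx'.
Qed.

(** Only an increasing subsequence through [a] and [c] is destroyed, and [b] can
    stand in for [a] in it. *)
Lemma peak_exchange1 e r s l m b a c : transitive e -> irreflexive e ->
    e a b -> e b c ->
  peak e r s (l ++ b :: a :: c :: m) -> peak e r s (l ++ b :: c :: a :: m).
Proof.
move=> e_tr e_irr lt_ab lt_bc [U [V [[subU subV] Uinc Vdec lens eq_last]]].
have lt_ac := e_tr _ _ _ lt_ab lt_bc.
have asym x y : e x y -> e y x -> False.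
  by move=> lt_xy /(e_tr _ _ _ lt_xy); rewrite e_irr.
have {}subV : subseq V (l ++ b :: c :: a :: m).
  move: subV; rewrite -!(cat_rcons b) => /subseq_swap[//|[V1 [V3 [V_eq _ _]]]].
  rewrite V_eq in Vdec; have [_ /= /andP[lt_ca _]] := sorted_conv_mid e_tr Vdec.
  by case: (asym _ _ lt_ac lt_ca).
move: (subU); rewrite -(cat_rcons b) => /subseq_swap[|[U1 [U3 [U_eq sub1 sub3]]]].
  by rewrite cat_rcons => {}subU; exists U, V.
move: Uinc; rewrite U_eq sorted_mid_trans //= => /and4P[U1inc U3inc U1_lt U3_lt].
exists (U1 ++ b :: c :: U3), V; split=> //.
- split=> //; apply: cat_subseq.
    apply: subseq_rcons_notin sub1; apply/negP => b_U1.
    exact: asym lt_ab (allP U1_lt _ b_U1).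
  apply: (@cat_subseq _ [:: b; c] U3 [:: b; c] (a :: m)); first exact: subseq_refl.
  exact: subseq_trans sub3 (subseq_cons _ _).
- rewrite sorted_mid_trans // U1inc /= lt_bc U3inc !andTb.
  apply/andP; split; first by apply: sub_all U1_lt => x lt_xa; apply: e_tr lt_ab.
  move: U3inc; rewrite (path_sortedE e_tr) => /andP[+ _].
  by apply: sub_all => x; apply: e_tr.
- by move: lens; rewrite U_eq !size_cat.
by rewrite -eq_last U_eq !last_cat.
Qed.

(** Again only an increasing subsequence through [a] and [c] is destroyed. If it
    goes on after [c], then [b] can stand in for [c]. If it ends at [c], then
    the peak moves to [b]: the increasing subsequence ends in [a], [b] instead
    of [a], [c], and the decreasing one is extended by [b]. *)
Lemma peak_exchange2 e r s l m b a c : transitive e -> irreflexive e ->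
    e a b -> e b c -> uniq (l ++ a :: c :: b :: m) -> 0 < s ->
  peak e r s (l ++ a :: c :: b :: m) -> peak e r s (l ++ c :: a :: b :: m).
Proof.
move=> e_tr e_irr lt_ab lt_bc w_uniq s_gt0 [U [V [[subU subV] Uinc Vdec lens eq_last]]].
have lt_ac := e_tr _ _ _ lt_ab lt_bc.
have asym x y : e x y -> e y x -> False.
  by move=> lt_xy /(e_tr _ _ _ lt_xy); rewrite e_irr.
have {}subV' : subseq V (l ++ c :: a :: b :: m).
  move: subV => /subseq_swap[//|[V1 [V3 [V_eq _ _]]]].
  rewrite V_eq in Vdec; have [_ /= /andP[lt_ca _]] := sorted_conv_mid e_tr Vdec.
  by case: (asym _ _ lt_ac lt_ca).
move: (subU) => /subseq_swap[|[U1 [U3 [U_eq sub1 sub3]]]].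
  by move=> {}subU; exists U, V.
move: Uinc; rewrite U_eq sorted_mid_trans //= => /and4P[U1inc U3inc U1_lt U3_lt].
have U1b_inc : sorted e (U1 ++ [:: a; b]).
  by rewrite sorted_mid_trans //= lt_ab U1inc U1_lt.
(* the case where the increasing subsequence ends at c *)
case: U3 => [|d U3] in U_eq sub3 U3inc U3_lt *.
  have V_last : last 0 V = c by rewrite -eq_last U_eq last_cat.
  case: (lastP V) lens V_last Vdec subV {subV' eq_last} => [|V' c'].
    by move=> []; rewrite leqn0; case: eqP s_gt0 => // ->.
  rewrite last_rcons => lens -> Vdec.
  rewrite -cats1 -(cat_rcons a) uniq_subseq_pivot ?cat_rcons // => /andP[subV _].
  have V'_gt : all (e c) V'.
    by move: Vdec; rewrite -cats1 => /(sorted_conv_mid e_tr)[].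
  exists (U1 ++ [:: a; b]), (rcons (rcons V' c) b); split.
  - split.
      apply: cat_subseq => //.
      exact: (subseq_trans (prefix_subseq [:: a; b] m) (subseq_cons (a :: b :: m) c)).
    rewrite -!cats1 -!catA; apply: cat_subseq.
      apply: subseq_rcons_notin subV; apply/negP => a_V'.
      exact: asym lt_ac (allP V'_gt _ a_V').
    apply: (@cat_subseq _ [:: c] [:: b] [:: c]); first exact: subseq_refl.
    by rewrite sub1seq !inE eqxx orbT.
  - by [].
  - by rewrite -cats1 cat_rcons sorted_cat_cons Vdec /= lt_bc.
  - move: lens; rewrite U_eq !size_cat !size_rcons /= => -[-> le_s]; split=> //.
    exact: leqW.
  by rewrite last_rcons last_cat.
exists (U1 ++ [:: a, b, d & U3]), V; split=> //.
- split=> //; apply: cat_subseq => //; apply: subseq_trans (subseq_cons _ _).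
  apply: (@cat_subseq _ [:: a; b] (d :: U3) [:: a; b] m); first exact: subseq_refl.
  move: sub3 => /=; case: eqP => // eq_db _; case: (asym _ _ lt_bc).
  by move: U3inc; rewrite /= eq_db => /andP[].
- rewrite sorted_mid_trans // U1inc U1_lt.
  move: U3_lt U3inc => /= /and3P[_ -> ->] /andP[/(e_tr _ _ _ lt_bc) -> ->].
  by rewrite lt_ab.
- by move: lens; rewrite U_eq !size_cat.
by rewrite -eq_last U_eq !last_cat.
Qed.

Inductive knuth : seq nat -> seq nat -> Prop :=
  | KnuthRefl w : knuth w w
  | KnuthSym w w' : knuth w w' -> knuth w' w
  | KnuthTrans w w' w'' : knuth w w' -> knuth w' w'' -> knuth w w''
  | KnuthBefore l m a b c of a < b < c :
      knuth (l ++ b :: a :: c :: m) (l ++ b :: c :: a :: m)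
  | KnuthAfter l m a b c of a < b < c :
      knuth (l ++ a :: c :: b :: m) (l ++ c :: a :: b :: m).

Lemma knuth_perm w w' : knuth w w' -> perm_eq w w'.
Proof.
elim=> {w w'} [w //|w w' _|w w' w'' _ /perm_trans IH _|l m a b c _|l m a b c _].
- by rewrite perm_sym.
- exact: IH.
- by rewrite perm_cat2l perm_cons -(cat1s a) -(cat1s c) perm_catCA.
by rewrite perm_cat2l -(cat1s a) -(cat1s c) perm_catCA.
Qed.

Lemma knuth_cat l m w w' : knuth w w' -> knuth (l ++ w ++ m) (l ++ w' ++ m).
Proof.
elim=> {w w'} [w|w w' _|w w' w'' _ /KnuthTrans IH _|l' m' a b c abc|l' m' a b c abc].
- exact: KnuthRefl.
- exact: KnuthSym.
- exact: IH.
- by rewrite -!catA !catA -!(catA _ (_ :: _)); apply: KnuthBefore.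
by rewrite -!catA !catA -!(catA _ (_ :: _)); apply: KnuthAfter.
Qed.

Lemma peak_knuth r s w w' : 0 < r -> 0 < s -> uniq w -> knuth w w' ->
  peak ltn r s w <-> peak ltn r s w'.
Proof.
move=> r_gt0 s_gt0 + kn; have gtn_trans : transitive gtn.
  by move=> y x z /= lt_yx lt_zy; apply: ltn_trans lt_yx.
have gtn_irr : irreflexive gtn by move=> x; apply: ltnn.
elim: kn => {w w'} [w //|w w' kn IH|w w' w'' kn IH _ IH'|
    l m a b c /andP[lt_ab lt_bc]|l m a b c /andP[lt_ab lt_bc]] w_uniq.
- by rewrite IH // (perm_uniq (knuth_perm kn)).
- by rewrite IH // IH' // -(perm_uniq (knuth_perm kn)).
- split; first by apply: (peak_exchange1 ltn_trans ltnn).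
  by rewrite !peak_conv; apply: (peak_exchange1 gtn_trans gtn_irr).
split; first by apply: (peak_exchange2 ltn_trans ltnn).
rewrite !peak_conv; apply: (peak_exchange2 gtn_trans gtn_irr) => //.
have /knuth_perm/perm_uniq <- // : knuth (l ++ a :: c :: b :: m) (l ++ c :: a :: b :: m).
by apply: KnuthAfter; rewrite lt_ab.
Qed.

Definition reading_word (P : filling) : seq nat := flatten (rev P).

Lemma reading_word_cons row P :
  reading_word (row :: P) = reading_word P ++ row.
Proof. by rewrite /reading_word rev_cons flatten_rcons. Qed.

(** The inserted letter travels to the left over the letters larger than the
    bumped one. *)
Lemma knuth_bump_right y v x : sorted ltn (y :: v) -> x < y ->
  knuth (y :: v ++ [:: x]) (y :: x :: v).
Proof.
elim: v y => [|z v IHv] y; first by move=> _ _; apply: KnuthRefl.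
move=> /andP[lt_yz zv_lt] lt_xy.
have kn := IHv z zv_lt (ltn_trans lt_xy lt_yz).
apply: (KnuthTrans (w' := [:: y, z, x & v])).
  by have := knuth_cat [:: y] [::] kn; rewrite !cats0.
by apply: KnuthSym; apply: (KnuthBefore [::]); rewrite lt_xy.
Qed.

(** The bumped letter travels to the left over the letters smaller than the
    inserted one. *)
Lemma knuth_bump_left u y x v : sorted ltn (u ++ x :: v) -> x < y ->
  knuth (u ++ y :: x :: v) (y :: u ++ x :: v).
Proof.
move=> + lt_xy; elim: u => [|a u IHu] //= ux_lt; first exact: KnuthRefl.
have kn := IHu (path_sorted ux_lt).
apply: (KnuthTrans (w' := [:: a, y & u ++ x :: v])).
  by have := knuth_cat [:: a] [::] kn; rewrite !cats0.
case: u ux_lt {IHu kn} => [|b u] /= /andP[lt_ab ub_lt].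
  by apply: (KnuthAfter [::]); rewrite lt_ab.
apply: (KnuthAfter [::]); rewrite lt_ab /=.
move: ub_lt; rewrite (path_sortedE ltn_trans) all_cat /= => /andP[/and3P[_ lt_bx _] _].
exact: ltn_trans lt_xy.
Qed.

Lemma knuth_insert P x : insertable P x ->
  knuth (rcons (reading_word P) x) (reading_word (insert P x)).
Proof.
elim: P x => [|row P IHP] x xP; first exact: KnuthRefl.
case: (insertP xP) => [_ _|u y v row_eq lt_xy yP row_lt row'_lt].
  by rewrite !reading_word_cons rcons_cat; apply: KnuthRefl.
rewrite !reading_word_cons row_eq -cats1 -!catA.
apply: (KnuthTrans (w' := reading_word P ++ y :: u ++ x :: v)).
  have kn : knuth (u ++ (y :: v) ++ [:: x]) (y :: u ++ x :: v).
    have yv_lt : sorted ltn (y :: v) by case/cat_sorted2: row_lt.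
    apply: KnuthTrans (knuth_bump_left row'_lt lt_xy).
    by have := knuth_cat u [::] (knuth_bump_right yv_lt lt_xy); rewrite !cats0.
  by have := knuth_cat (reading_word P) [::] kn; rewrite !cats0.
by have := knuth_cat [::] (u ++ x :: v) (IHP y yP); rewrite cat_rcons.
Qed.

Lemma insertion_spec w (P := foldl insert [::] w) : uniq w ->
  [/\ tableau ltn P, perm_eq (flatten P) w & knuth w (reading_word P)].
Proof.
rewrite {}/P; elim/last_ind: w => [|w x IHw]; first by split=> //; apply: KnuthRefl.
rewrite rcons_uniq foldl_rcons => /andP[x_w w_uniq].
have [Ptab P_perm kn] := IHw w_uniq.
have xP : insertable (foldl insert [::] w) x.
  case/and3P: Ptab => _ P_lt _.
  by rewrite /insertable P_lt /= (perm_mem P_perm) x_w (perm_uniq P_perm).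
split; first exact: tableau_insert.
  have [_ /perm_trans -> //] := insertable_insert xP.
  by rewrite perm_sym perm_rcons perm_cons perm_sym.
apply: KnuthTrans (knuth_insert xP).
by have := knuth_cat [::] [:: x] kn; rewrite /= !cats1.
Qed.

(** * Peaks of the reading word of a tableau *)

Lemma count_above u v z : above u v -> count (geq z) v <= count (gtn z) u.
Proof.
elim: u v => [|x u IHu] [|y v] //= /andP[lt_xy /IHu]; apply: leq_add.
by case: (leqP y z) => //= le_yz; rewrite (leq_trans lt_xy).
Qed.

(** An increasing subsequence of the reading word moves strictly to the right
    from one letter to the next, so one that ends at [x] in column [j] has at
    most [j] letters. Counting the letters of the first row that are at most [x]
    gives a bound that is suited to induction on the rows. *)
Lemma size_inc_subseq P U :
    tableau ltn P -> sorted ltn U -> subseq U (reading_word P) ->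
  size U <= count (geq (last 0 U)) (head [::] P).
Proof.
elim: P U => [|row P IHP] U; first by move=> _ _; rewrite subseq0 => /eqP ->.
rewrite tableau_cons reading_word_cons => /and4P[_ _ abv Ptab] + /subseq_catP[U1 [U2 [U_eq]]].
rewrite {U}U_eq => U12_lt sub1 sub2; have [U1_lt U2_lt] := cat_sorted2 U12_lt.
have le_U1 := leq_trans (IHP U1 Ptab U1_lt sub1) (count_above _ abv).
case: U2 => [|b U2] in U12_lt U2_lt sub2 *.
  by rewrite cats0 (leq_trans le_U1) //; apply: sub_count => y; apply: ltnW.
rewrite size_cat last_cat [last _ (b :: U2)]/= [head _ _]/=.
set l1 := last 0 U1 in le_U1 *; set l := last b U2.
have U2_in : all (fun y => l1 <= y <= l) (b :: U2).
  apply/allP => y y_U2; apply/andP; split.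
    rewrite /l1; case: (lastP U1) U12_lt => // U1' a; rewrite cat_rcons sorted_mid last_rcons.
    by case/and4P=> _ _ _ /allP /(_ y y_U2) /ltnW.
  move: y_U2 U2_lt; rewrite /l lastI -cats1 sorted_mid mem_cat => /orP[y_in|].
    by case/and4P=> _ _ /allP /(_ y y_in) /ltnW.
  by rewrite inE => /eqP ->.
(* U1 is bounded by the letters of the row below l1; U2 uses letters from l1 on *)
have le_U2 : size (b :: U2) <= count (fun y => l1 <= y <= l) row.
  by rewrite -(eqP (etrans (esym (all_count _ _)) U2_in)); apply: leq_count_subseq.
apply: leq_trans (leq_add le_U1 le_U2) _.
have lt_l : l1 <= l by case/andP: U2_in => /andP[le1 le2] _; apply: leq_trans le2.
elim: (row) => //= y r; case: (ltnP y l1) => /= [lt_y|le_y]; last by lia.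
by rewrite (leq_trans (ltnW lt_y) lt_l); lia.
Qed.

Definition shift_box (c : nat * nat) : nat * nat := (c.1.+1, c.2).

Notation row_before := (fun c d : nat * nat => c.1 < d.1).

(** A decreasing subsequence takes at most one letter from each row, because
    rows increase. Reading the word backwards lists the boxes from the top row
    down, which is the order used by ascending sequences. *)
Lemma boxes_of_dec P V : tableau ltn P -> sorted ltn V ->
    subseq V (rev (reading_word P)) ->
  exists b, [/\ [seq entry P c.1 c.2 | c <- b] = V,
    all (fun c => in_diagram P c.1 c.2) b & sorted row_before b].
Proof.
elim: P V => [|row P IHP] V; first by move=> _ _; rewrite subseq0 => /eqP ->; exists [::].
rewrite tableau_cons reading_word_cons rev_cat => /and4P[_ row_sort _ Ptab].
move=> + /subseq_catP[V1 [V2 [V_eq sub1 sub2]]]; rewrite {V}V_eq => V_lt.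
have [V1_lt V2_lt] := cat_sorted2 V_lt.
have [b [b_V b_in b_sorted]] := IHP V2 Ptab V2_lt sub2.
have shift_in : all (fun c => in_diagram (row :: P) c.1 c.2) (map shift_box b).
  by rewrite all_map.
have shift_sorted : sorted row_before (map shift_box b) by rewrite sorted_map.
have shift_V : [seq entry (row :: P) c.1 c.2 | c <- map shift_box b] = V2.
  by rewrite -map_comp -b_V.
case: V1 => [|y [|z V1]] in V_lt V1_lt sub1 *; first by exists (map shift_box b).
  exists ((0, index y row) :: map shift_box b).
  have y_row : y \in row by rewrite -mem_rev -sub1seq.
  split; rewrite /= ?shift_V /entry /= ?nth_index //.
    by rewrite /in_diagram /= index_mem y_row.
  by rewrite path_sortedE ?shift_sorted ?andbT ?all_map; [apply/allP | move=> c d e; apply: ltn_trans].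
have : sorted gtn (rev row) by rewrite rev_sorted.
have gtn_trans : transitive gtn.
  by move=> y' x' z' /= lt_yx lt_zy; apply: ltn_trans lt_yx.
move/(subseq_sorted gtn_trans sub1) => /= /andP[+ _].
by case/andP: V1_lt => /= /ltnW + _; rewrite leqNgt => /negP.
Qed.

Lemma dec_of_boxes P b :
    all (fun c => in_diagram P c.1 c.2) b -> sorted row_before b ->
  subseq [seq entry P c.1 c.2 | c <- b] (rev (reading_word P)).
Proof.
have row_lt_trans : transitive row_before by move=> c d e; apply: ltn_trans.
have unshift b' : all (fun c => 0 < c.1) b' -> exists b'', b' = map shift_box b''.
  elim: b' => [|[[|i] j] b' IHb'] //=; first by exists [::].
  by move=> /IHb'[b'' ->]; exists ((i, j) :: b'').
elim: P b => [|row P IHP] b.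
  by case: b => // c b; rewrite /in_diagram /= nth_nil.
have shifted b' : all (fun c => in_diagram (row :: P) c.1 c.2) b' ->
    sorted row_before b' -> all (fun c => 0 < c.1) b' ->
    subseq [seq entry (row :: P) c.1 c.2 | c <- b'] (rev (reading_word P)).
  move=> + + /unshift[b'' b'_eq]; rewrite b'_eq all_map sorted_map -map_comp => b_in b_sort.
  exact: IHP.
rewrite reading_word_cons rev_cat.
case: b => [|[[|i] j] b] b_in b_sort; first exact: sub0seq.
  move: b_sort; rewrite /= (path_sortedE row_lt_trans) => /andP[b_gt b_sort].
  case/andP: b_in => /= j_in b_in.
  rewrite -cat1s; apply: cat_subseq; last exact: shifted.
  by rewrite sub1seq mem_rev; apply: mem_nth.
apply: subseq_trans (suffix_subseq _ _); apply: shifted => //=.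
move: b_sort; rewrite /= (path_sortedE row_lt_trans) => /andP[b_gt _].
by apply: sub_all b_gt => c; apply: leq_trans.
Qed.

Lemma count_geq_nth (row : seq nat) r x : sorted ltn row -> 0 < r ->
  r <= count (geq x) row -> r.-1 < size row /\ nth 0 row r.-1 <= x.
Proof.
elim: row r => [|y row IHrow] r; first by move=> _ r_gt0; rewrite leqNgt r_gt0.
rewrite /= (path_sortedE ltn_trans) => /andP[y_lt row_lt] r_gt0.
case: (leqP y x) => [le_yx|lt_xy]; rewrite ?add1n ?add0n => le_r.
  by case: r r_gt0 le_r => [|[|r]] //= _; rewrite ltnS => /(IHrow r.+1 row_lt)[].
have count0 : count (geq x) row = 0.
  apply/eqP; rewrite -leqn0 leqNgt -has_count; apply/hasPn => z /(allP y_lt) /= lt_yz.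
  by rewrite -ltnNge (ltn_trans lt_xy).
by move: le_r r_gt0; rewrite count0 leqn0 => /eqP ->.
Qed.

(** An ascending sequence is a decreasing subsequence of the reading word that
    ends in the first row in column [r], where the first [r] letters of this row
    form the increasing subsequence. Conversely, let [x] be the end of the two
    subsequences of a peak. By [size_inc_subseq] the first row has a letter in
    column [r], and it is at most [x]; so it can replace [x] as the start of
    the ascending sequence. *)
Lemma peak_reading_word r s P : 0 < r -> 0 < s -> tableau ltn P ->
  peak ltn r s (reading_word P) <-> has_ascending r s P.
Proof.
move=> r_gt0 s_gt0 Ptab; split=> [[U [V [[subU subV] U_lt V_gt [le_r le_s] eq_last]]]|].
  have [r_in le_x] : r.-1 < size (head [::] P) /\ nth 0 (head [::] P) r.-1 <= last 0 U.
    apply: count_geq_nth => //; last exact: leq_trans (size_inc_subseq Ptab U_lt subU).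
    by case/and3P: Ptab => _ + _; case: (P) => //= row P' /andP[].
  rewrite -nth0 in r_in le_x.
  have V'_lt : sorted ltn (rev V) by rewrite rev_sorted.
  have [b [b_V b_in b_sort]] : exists b, _ :=
    boxes_of_dec Ptab V'_lt (etrans (subseq_rev _ _) subV).
  split=> //.
  case: b b_V b_in b_sort => [|c b].
    by move/(congr1 size); rewrite size_rev => /esym V0; rewrite V0 leqNgt s_gt0 in le_s.
  move=> b_V /= /andP[c_in b_in] b_sort.
  have row_lt_trans : transitive row_before by move=> c1 d e; apply: ltn_trans.
  move: b_sort; rewrite (path_sortedE row_lt_trans) => /andP[b_gt b_sort].
  have size_V : size V = (size b).+1 by rewrite -size_rev -b_V /= size_map.
  have c_last : entry P c.1 c.2 = last 0 V.
    by move: (congr1 (head 0) b_V) => /= ->; rewrite -nth0 nth_rev ?subn1 ?nth_last // size_V.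
  (* the peak is replaced by the entry of the first row in column r *)
  exists ((0, r.-1) :: take s.-1 b); split=> //=.
  - split; first by rewrite size_takel ?prednK // -ltnS prednK // -size_V.
    rewrite [in_diagram _ _ _]r_in; apply/allP => d /mem_take; exact: (allP b_in).
  - rewrite (path_sortedE row_lt_trans) take_sorted // andbT.
    by apply/allP => d /mem_take /(allP b_gt); apply: leq_ltn_trans.
  have e_trans : transitive (fun c d : nat * nat => entry P c.1 c.2 < entry P d.1 d.2).
    by move=> c1 d e; apply: ltn_trans.
  rewrite (path_sortedE e_trans).
  move: V'_lt; rewrite -b_V sorted_map /= (path_sortedE e_trans) => /andP[c_lt bE_sort].
  rewrite take_sorted // andbT; apply/allP => d /mem_take /(allP c_lt).
  by apply: leq_ltn_trans; rewrite c_last -eq_last.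
case=> r_in [[|c b] [[size_b b_in] c_row c_entry b_sort b_lt]] /=.
  by rewrite -size_b in s_gt0.
have r_size : r <= size (nth [::] P 0) by move: r_in; rewrite /in_diagram; case: (r) r_gt0.
exists (take r (nth [::] P 0)), (rev [seq entry P d.1 d.2 | d <- c :: b]).
split.
- split; last by rewrite -[reading_word P]revK subseq_rev; apply: dec_of_boxes.
  apply: subseq_trans (take_subseq _ _) _.
  case: (P) => [|row P']; first by rewrite nth_nil sub0seq.
  by rewrite reading_word_cons; apply: suffix_subseq.
- apply: take_sorted; case/and3P: Ptab => _ + _.
  by case: (P) => //= row P' /andP[].
- by rewrite rev_sorted sorted_map.
- by rewrite size_takel // size_rev size_map size_b.
rewrite -nth_last size_takel // nth_take ?prednK //.
by rewrite -nth_last size_rev nth_rev ?size_map //= subnn.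
Qed.

(** * Pattern containment on words *)

Lemma size_word n (p : 'S_n) : size (word p) = n.
Proof. by rewrite size_map size_enum_ord. Qed.

Lemma nth_word n (p : 'S_n) (i : 'I_n) : nth 0 (word p) i = (p i).+1.
Proof. by rewrite (nth_map i) ?size_enum_ord // nth_ord_enum. Qed.

Lemma word_uniq n (p : 'S_n) : uniq (word p).
Proof.
by rewrite map_inj_uniq ?enum_uniq // => i j /succn_inj /val_inj /perm_inj.
Qed.

Lemma perm_word n (p : 'S_n) : perm_eq (word p) (iota 1 n).
Proof.
apply: uniq_perm; rewrite ?word_uniq ?iota_uniq // => a; rewrite mem_iota add1n.
apply/mapP/andP => [[i _ ->]|[a_gt0 le_a]].
  by rewrite !ltnS leq0n ltn_ord.
have lt_a : a.-1 < n by lia.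
exists (perm_inv p (Ordinal lt_a)); first by rewrite mem_enum.
by rewrite permKV /= prednK.
Qed.

Lemma word_inj n : injective (@word n).
Proof.
move=> p q eq_pq; apply/permP => i; apply: val_inj; apply: succn_inj.
by rewrite -!nth_word eq_pq.
Qed.

Lemma word_surj n (w : seq nat) :
  perm_eq w (iota 1 n) -> exists p : 'S_n, word p = w.
Proof.
move=> w_perm; have w_size : size w = n by rewrite (perm_size w_perm) size_iota.
have w_uniq : uniq w by rewrite (perm_uniq w_perm) iota_uniq.
have w_nth (i : 'I_n) : 0 < nth 0 w i < n.+1.
  by rewrite -mem_iota -(perm_mem w_perm) mem_nth ?w_size.
have lt_n (i : 'I_n) : (nth 0 w i).-1 < n.
  by have := w_nth i; lia.
have f_inj : injective (fun i => Ordinal (lt_n i)).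
  move=> i j [] eq_ij; apply/val_inj/eqP; rewrite -(nth_uniq 0 _ _ w_uniq) ?w_size ?ltn_ord //.
  have /andP[gt0i _] := w_nth i; have /andP[gt0j _] := w_nth j.
  by rewrite -(prednK gt0i) eq_ij prednK.
exists (perm f_inj); apply: (@eq_from_nth _ 0); rewrite size_word // => i lt_i.
rewrite (nth_word _ (Ordinal lt_i)) permE /= prednK //.
by have /andP[] := w_nth (Ordinal lt_i).
Qed.

Definition same_order (v w : seq nat) : Prop :=
  size v = size w /\ forall i j, i < size v -> j < size v ->
    (nth 0 v i < nth 0 v j) = (nth 0 w i < nth 0 w j).

(** The subsequences of the word of [q] are the words of its restrictions to
    increasing sequences of positions. *)
Lemma containsP n k (q : 'S_n) (p : 'S_k) :
  contains q p <-> exists2 v, subseq v (word q) & same_order v (word p).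
Proof.
have lt_trans m : transitive (fun i j : 'I_m => i < j) by move=> i j l; apply: ltn_trans.
have lt_irr m : irreflexive (fun i j : 'I_m => i < j) by move=> i; apply: ltnn.
have enum_sorted m : sorted (fun i j : 'I_m => i < j) (enum 'I_m).
  by have := iota_ltn_sorted 0 m; rewrite -val_enum_ord sorted_map.
split=> [/existsP[f /andP[/forallP f_inc /forallP f_ord]]|].
  have f_lt (i j : 'I_k) : i < j -> f i < f j.
    by move/forallP: (f_inc i) => /(_ j)/implyP.
  have f_pat (i j : 'I_k) : (q (f i) < q (f j)) = (p i < p j).
    by move/forallP: (f_ord i) => /(_ j)/eqP.
  exists [seq (val (q (f i))).+1 | i <- enum 'I_k].
    rewrite (map_comp (fun i => (val (q i)).+1) f); apply: map_subseq.
    have f_sorted : sorted (fun i j : 'I_n => i < j) [seq f i | i <- enum 'I_k].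
      by rewrite sorted_map; apply: sub_sorted (enum_sorted k) => i j /f_lt.
    have -> : [seq f i | i <- enum 'I_k] =
        filter (mem [seq f i | i <- enum 'I_k]) (enum 'I_n).
      apply: (irr_sorted_eq (lt_trans n) (lt_irr n) f_sorted) => [|i].
        exact: sorted_filter (lt_trans n) _ _ (enum_sorted n).
      by rewrite mem_filter mem_enum andbT.
    exact: filter_subseq.
  split; first by rewrite size_map size_enum_ord size_word.
  rewrite size_map size_enum_ord => i j lt_i lt_j.
  rewrite (nth_word p (Ordinal lt_i)) (nth_word p (Ordinal lt_j)) ltnS -f_pat.
  have nth_v (l : 'I_k) : nth 0 [seq (val (q (f i))).+1 | i <- enum 'I_k] l = (q (f l)).+1.
    by rewrite (nth_map l) ?size_enum_ord // nth_ord_enum.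
  by rewrite (nth_v (Ordinal lt_i)) (nth_v (Ordinal lt_j)) ltnS.
case=> v /subseqP[msk]; rewrite size_word => msk_size v_eq [v_size v_ord].
set e := mask msk (enum 'I_n); rewrite -map_mask -/e in v_eq.
have e_size : size e == k by rewrite -(size_word p) -v_size v_eq size_map.
have e_sorted : sorted (fun i j : 'I_n => i < j) e.
  exact: (sorted_mask (lt_trans n) _ (enum_sorted n)).
pose t := Tuple e_size.
apply/existsP; exists [ffun i => tnth t i]; apply/andP; split.
  apply/forallP => i; apply/forallP => j; apply/implyP => lt_ij.
  have x0 : 'I_n := tnth t i.
  rewrite !ffunE !(tnth_nth x0) /=.
  by apply: (sorted_ltn_nth (lt_trans n)) => //; rewrite inE (eqP e_size).
apply/forallP => i; apply/forallP => j; apply/eqP; rewrite !ffunE.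
have nth_v (l : 'I_k) : nth 0 v l = (q (tnth t l)).+1.
  have x0 : 'I_n := tnth t l.
  by rewrite v_eq (tnth_nth x0) (nth_map x0) ?(eqP e_size).
have := v_ord i j; rewrite v_size size_word !nth_word !nth_v !ltnS.
by apply; apply: ltn_ord.
Qed.

Lemma peak_subseq e r s v w : subseq v w -> peak e r s v -> peak e r s w.
Proof.
move=> sub_vw [U [V [[subU subV] Uinc Vdec lens eq_last]]].
by exists U, V; split=> //; split; apply: subseq_trans sub_vw.
Qed.

Lemma peak_same_order r s v w : 0 < r -> 0 < s -> uniq v -> same_order v w ->
  peak ltn r s v -> peak ltn r s w.
Proof.
move=> r_gt0 s_gt0 v_uniq [size_vw ord_vw] [U [V [[subU subV] Uinc Vdec lens eq_last]]].
pose h y := nth 0 w (index y v).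
have w_eq : w = map h v.
  apply: (@eq_from_nth _ 0); rewrite ?size_map // -size_vw => i lt_i.
  by rewrite (nth_map 0) // /h index_uniq.
have h_lt y z : y \in v -> z \in v -> (h y < h z) = (y < z).
  by move=> y_v z_v; rewrite /h -ord_vw ?index_mem // !nth_index.
have last_h (W : seq nat) : 0 < size W -> last 0 (map h W) = h (last 0 W).
  by case: W => //= y W _; rewrite last_map.
exists (map h U), (map h V); rewrite w_eq; split.
- by split; apply: map_subseq.
- rewrite sorted_map; apply: (@sub_in_sorted _ (mem v)) Uinc => [y z y_v z_v|].
    by rewrite /= h_lt.
  by apply/allP => y; apply: mem_subseq.
- rewrite sorted_map; apply: (sub_in_sorted (P := mem v)) Vdec => [y z y_v z_v|].
    by rewrite /= h_lt.
  by apply/allP => y; apply: mem_subseq.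
- by rewrite !size_map.
case: lens => le_r le_s.
by rewrite (last_h U (leq_trans r_gt0 le_r)) (last_h V (leq_trans s_gt0 le_s)) eq_last.
Qed.

(** Truncate the two subsequences at the front to the lengths [r] and [s]. They
    meet only in their common last letter, since the other letters of the first
    are smaller and those of the second larger, so together they have
    [r + s - 1] letters. *)
Lemma peak_extract r s w : 0 < r -> 0 < s -> uniq w -> peak ltn r s w ->
  exists v, [/\ subseq v w, size v = r + s.-1 & peak ltn r s v].
Proof.
move=> r_gt0 s_gt0 w_uniq [U0 [V0 [[subU0 subV0] U0inc V0dec [le_r le_s] eq_last0]]].
have gtn_trans : transitive gtn.
  by move=> y' x' z' /= lt_yx lt_zy; apply: ltn_trans lt_yx.
have suffix m W : 0 < m -> m <= size W -> exists W',
    [/\ subseq W' W, size W' = m & last 0 W' = last 0 W].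
  move=> m_gt0 le_m; exists (drop (size W - m) W).
  rewrite drop_subseq size_drop subKn //; split=> //.
  rewrite -[in RHS](cat_take_drop (size W - m) W) last_cat.
  by case: (drop _ _) (size_drop (size W - m) W) => //=; rewrite subKn // => m0; lia.
have [U [subU sizeU lastU]] := suffix r U0 r_gt0 le_r.
have [V [subV sizeV lastV]] := suffix s V0 s_gt0 le_s.
have Uinc : sorted ltn U := subseq_sorted ltn_trans subU U0inc.
have Vdec : sorted gtn V := subseq_sorted gtn_trans subV V0dec.
have {}subU := subseq_trans subU subU0; have {}subV := subseq_trans subV subV0.
have eq_last : last 0 U = last 0 V by rewrite lastU lastV.
case/lastP: V => [|V x] in sizeV lastV Vdec subV eq_last *.
  by rewrite -sizeV in s_gt0.
case/lastP: U => [|U y] in sizeU lastU Uinc subU eq_last *.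
  by rewrite -sizeU in r_gt0.
move: eq_last; rewrite !last_rcons => eq_yx; rewrite {y}eq_yx in sizeU lastU Uinc subU *.
have := Uinc; rewrite -cats1 sorted_mid => /and4P[_ _ /allP U_lt _].
have := Vdec; rewrite -cats1 (sorted_mid_trans _ _ _ gtn_trans) => /and4P[_ _ /allP V_gt _].
exists [seq z <- w | z \in rcons U x ++ V]; split; first exact: filter_subseq.
  have UV_uniq : uniq (rcons U x ++ V).
    rewrite cat_uniq (subseq_uniq subU w_uniq).
    have := subseq_uniq subV w_uniq; rewrite rcons_uniq => /andP[_ ->]; rewrite andbT.
    apply/hasPn => z /V_gt /= lt_xz; rewrite mem_rcons inE negb_or gtn_eqF //=.
    by apply/negP => /U_lt /=; lia.
  have UV_sub z : z \in rcons U x ++ V -> z \in w.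
    rewrite mem_cat => /orP[/(mem_subseq subU) //|z_V].
    by apply: (mem_subseq subV); rewrite mem_rcons inE z_V orbT.
  have /perm_size -> : perm_eq [seq z <- w | z \in rcons U x ++ V] (rcons U x ++ V).
    apply: uniq_perm => //; first exact: filter_uniq.
    by move=> z; rewrite mem_filter andb_idr //; apply: UV_sub.
  by rewrite size_cat sizeU -sizeV size_rcons.
exists (rcons U x), (rcons V x); rewrite sizeU sizeV !last_rcons; split=> //.
by split; rewrite subseq_filter ?subU ?subV ?andbT; apply/allP => z;
  rewrite mem_cat !mem_rcons !inE => /orP[]->; rewrite ?orbT.
Qed.

(** * The Knuth class of a hook *)

Lemma row_superstandard_hook r t :
  row_superstandard (r :: nseq t 1) =
  iota 1 r :: [seq [:: a] | a <- iota r.+1 t].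
Proof.
rewrite /row_superstandard /= sumn_nseq mul1n iotaD take_size_cat ?size_iota //.
rewrite drop_size_cat ?size_iota // add1n; congr cons.
by elim: t r.+1 => //= t IHt a; rewrite drop0 take0 IHt.
Qed.

Lemma peak_hook r s : 0 < r -> 0 < s ->
  peak ltn r s (reading_word (row_superstandard (r :: nseq s.-1 1))).
Proof.
move=> r_gt0 s_gt0; rewrite row_superstandard_hook reading_word_cons /reading_word.
rewrite -map_rev -[flatten _]/(flatten [seq [:: a] | a <- rev (iota r.+1 s.-1)]) flatten_seq1.
exists (iota 1 r), (rcons (rev (iota r.+1 s.-1)) r); split.
- split; first exact: suffix_subseq.
  rewrite -cats1; apply: cat_subseq => //.
  by rewrite sub1seq mem_iota add1n ltnS leqnn r_gt0.
- exact: iota_ltn_sorted.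
- have := iota_ltn_sorted r s; rewrite -(prednK s_gt0) /= -rev_cons rev_sorted.
  by [].
- by rewrite size_iota size_rcons size_rev size_iota prednK.
by rewrite last_rcons -nth_last size_iota nth_iota ?prednK // add1n prednK.
Qed.

(** The first row has at least [r] entries and the [s - 1] later boxes lie in
    distinct lower rows; with [r + s - 1] entries in all, this leaves only the
    hook shape. The ascending sequence then runs down the first column, below
    the first row, and its start is the last entry of the first row: the
    entries read row by row increase, as in the row superstandard tableau. *)
Lemma hook_of_ascending r s P : 0 < r -> 0 < s -> tableau ltn P ->
    perm_eq (flatten P) (iota 1 (r + s.-1)) -> has_ascending r s P ->
  P = row_superstandard (r :: nseq s.-1 1).
Proof.
move=> r_gt0 s_gt0 Ptab P_perm [r_in [[|c b] [[/= size_b b_in] c_row c_entry b_sort b_lt]]].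
  by rewrite -size_b in s_gt0.
have {}size_b : size b = s.-1 by rewrite -size_b.
have row_lt_trans : transitive row_before by move=> c1 d e; apply: ltn_trans.
have e_trans : transitive (fun c d : nat * nat => entry P c.1 c.2 < entry P d.1 d.2).
  by move=> c1 d e; apply: ltn_trans.
move: b_sort b_lt; rewrite (path_sortedE row_lt_trans) (path_sortedE e_trans).
move=> /andP[/allP b_gt b_sort] /andP[/allP lt_b b_lt].
case/andP: b_in => _ /allP b_in.
case: P => [|row P] in Ptab P_perm r_in b_in c_row c_entry b_lt lt_b e_trans *; first by [].
have r_size : r <= size row by move: r_in; rewrite /in_diagram /=; case: (r) r_gt0.
have size_P : size (flatten (row :: P)) = r + s.-1.
  by rewrite (perm_size P_perm) size_iota.
have := Ptab; rewrite tableau_cons => /and4P[row0 row_sort _ P'tab].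
have P_rows : s.-1 <= size P.
  rewrite -size_b -(size_map fst) -(size_iota 1 (size P)); apply: uniq_leq_size.
    have fst_sort : sorted ltn (map fst b) by rewrite sorted_map.
    exact: (sorted_uniq ltn_trans ltnn).
  move=> i /mapP[d d_b ->]; rewrite mem_iota (leq_ltn_trans _ (b_gt d d_b)) //.
  rewrite add1n; have := b_in d d_b; rewrite /in_diagram => lt_d.
  by rewrite ltnNge; apply/negP => le_d; rewrite nth_default in lt_d.
have size_rows (U : filling) : [::] \notin U -> size U <= size (flatten U) ?= iff all (fun u => size u == 1) U.
  elim: U => [|u U IHU] //=; rewrite inE negb_or => /andP[u0 /IHU].
  rewrite size_cat -[(size U).+1]add1n; apply: leqif_add; apply/leqifP.
  by case: u u0 => //= a [|a' u].
have no_nil : [::] \notin P by case/and3P: P'tab.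
have := size_rows P no_nil; move: size_P; rewrite /= size_cat => size_P leif_P.
(* r <= size row, s - 1 <= size P <= size (flatten P), and the sizes add up to
   r + s - 1 *)
have [eq_r [eq_P eq_flat]] : size row = r /\ size P = s.-1 /\ size (flatten P) = s.-1.
  have := leif_P.1; lia.
have P_single : all (fun u => size u == 1) P by rewrite -leif_P.2 eq_P eq_flat.
have P_map : P = [seq [:: a] | a <- flatten P].
  elim: (P) P_single => //= u U IHU /andP[+ /IHU {1}->].
  by case: u => [|a []].
have flat_sort : sorted ltn (flatten P).
  case/and3P: P'tab => _ _; rewrite {1}P_map sorted_map; apply: sub_sorted => x y /=.
  by rewrite andbT.
have bE_sort : sorted ltn [seq entry (row :: P) d.1 d.2 | d <- b] by rewrite sorted_map.
have b_flat : [seq entry (row :: P) d.1 d.2 | d <- b] = flatten P.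
  apply: (irr_sorted_eq ltn_trans ltnn) => //.
  have [] // := @uniq_min_size _ [seq entry (row :: P) d.1 d.2 | d <- b] (flatten P).
  - exact: (sorted_uniq ltn_trans ltnn).
  - move=> x /mapP[d d_b ->]; have := b_gt d d_b; have := b_in d d_b.
    rewrite /in_diagram /entry; case: d.1 => //= i lt_d _.
    apply/flattenP; exists (nth [::] P i); last exact: mem_nth.
    by apply: mem_nth; rewrite ltnNge; apply/negP => le_d; rewrite nth_default in lt_d.
  by rewrite size_map size_b eq_flat.
have P_sort : sorted ltn (flatten (row :: P)).
  have [row' [x row_eq]] : exists row' x, row = rcons row' x.
    by case: (lastP row) row0 => // row' x _; exists row', x.
  rewrite /= -b_flat {1}row_eq cat_rcons sorted_mid bE_sort all_map /=.
  move: row_sort; rewrite row_eq -cats1 sorted_mid => /and4P[-> _ -> _] /=.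
  have c_x : entry (row :: P) c.1 c.2 = x.
    by rewrite c_entry /entry /= -eq_r row_eq size_rcons nth_rcons ltnn eqxx.
  apply/allP => d d_b /=; rewrite cats1 -row_eq -c_x.
  exact: lt_b.
have P_flat : flatten (row :: P) = iota 1 (r + s.-1).
  apply: (irr_sorted_eq ltn_trans ltnn) => //; first exact: iota_ltn_sorted.
  exact: perm_mem.
rewrite -[LHS]flattenK P_flat /row_superstandard.
have -> : shape (row :: P) = r :: nseq s.-1 1.
  rewrite /shape map_cons eq_r -eq_P -(size_map size); congr cons.
  by apply/all_pred1P; rewrite all_map.
by have -> : sumn (r :: nseq s.-1 1) = r + s.-1 by rewrite /= sumn_nseq mul1n.
Qed.

(** Replace each letter by its rank. *)
Lemma standardization k (v : seq nat) : uniq v -> size v = k ->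
  exists p : 'S_k, same_order v (word p).
Proof.
move=> v_uniq v_size; pose rank a := count (gtn a) v.
have rank_lt a b : a \in v -> a < b -> rank a < rank b.
  move=> a_v lt_ab; have le_rank : count (predU (gtn a) (pred1 a)) v <= rank b.
    by apply: sub_count => c /= /orP[lt_ca|/eqP -> //]; apply: ltn_trans lt_ab.
  apply: leq_trans le_rank; rewrite -[X in X <= _]addn0.
  have disj c : predI (gtn a) (pred1 a) c = pred0 c.
    by rewrite /=; case: eqP => [->|]; rewrite ?ltnn ?andbF.
  have := count_predUI (gtn a) (pred1 a) v; rewrite (eq_count disj) count_pred0 addn0.
  by rewrite addn0 => ->; rewrite -[X in X < _]addn0 ltn_add2l -has_count has_pred1.
have rank_mono : {in v &, {mono rank : a b / a < b}}.
  move=> a b a_v b_v; case: (ltngtP a b) => [/(rank_lt _ _ a_v) //|/(rank_lt _ _ b_v)|->].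
    by move=> lt_r; apply/negbTE; rewrite -leqNgt ltnW.
  by rewrite ltnn.
have lt_k a : a \in v -> rank a < k.
  move=> a_v; rewrite -v_size -(count_predC (gtn a) v) -[X in X < _]addn0 ltn_add2l.
  by rewrite -has_count; apply/hasP; exists a; rewrite //= ltnn.
have rank_inj : {in v &, injective (fun a => (rank a).+1)}.
  move=> a b a_v b_v [eq_ab]; have := rank_mono a b a_v b_v.
  have := rank_mono b a b_v a_v; rewrite eq_ab ltnn => /esym ba /esym ab.
  by apply/eqP; rewrite eqn_leq [a <= b]leqNgt [b <= a]leqNgt ab ba.
have w_uniq : uniq [seq (rank a).+1 | a <- v] by rewrite map_inj_in_uniq.
have [p p_word] : exists p : 'S_k, word p = [seq (rank a).+1 | a <- v].
  apply: word_surj; apply: uniq_perm; rewrite ?iota_uniq //.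
  have [] // := @uniq_min_size _ [seq (rank a).+1 | a <- v] (iota 1 k).
    by move=> _ /mapP[a a_v ->]; rewrite mem_iota add1n !ltnS lt_k.
  by rewrite size_map size_iota v_size.
exists p; rewrite p_word; split; first by rewrite size_map.
by move=> i j lt_i lt_j; rewrite !(nth_map 0) // ltnS rank_mono ?mem_nth.
Qed.

(** A member of the Knuth class has a peak since its insertion tableau has one.
    Conversely, a peak of [q] gives a pattern of [r + s - 1] letters with a
    peak, and such a pattern is in the class by [hook_of_ascending]. *)
Lemma contains_knuth_class r s n (q : 'S_n) : 0 < r -> 0 < s ->
  let R := row_superstandard (r :: nseq s.-1 1) in
  (exists2 p, p \in knuth_class R & contains q p) <->
  has_ascending r s (insertion_tableau q).
Proof.
move=> r_gt0 s_gt0 R.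
have [Qtab _ Qkn] := insertion_spec (word_uniq q).
rewrite -(peak_reading_word r_gt0 s_gt0 Qtab) -(peak_knuth r_gt0 s_gt0 (word_uniq q) Qkn).
have R_size : sumn (shape R) = r + s.-1.
  by rewrite /R row_superstandard_hook -size_flatten /= size_cat flatten_seq1 !size_iota.
split=> [[p]|].
  rewrite inE => /eqP pR /containsP[v sub_v [size_v ord_v]].
  have [_ _ Pkn] := insertion_spec (word_uniq p).
  rewrite -[foldl _ _ _]/(insertion_tableau p) pR in Pkn.
  apply: peak_subseq sub_v _; apply: (@peak_same_order _ _ (word p)) => //.
  - exact: word_uniq.
  - by split=> // i j lt_i lt_j; rewrite ord_v // size_v.
  by apply/(peak_knuth r_gt0 s_gt0 (word_uniq p) Pkn)/peak_hook.
case/(peak_extract r_gt0 s_gt0 (word_uniq q)) => v [sub_v size_v peak_v].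
have [p p_ord] : exists p : 'S_(sumn (shape R)), same_order v (word p).
  by apply: standardization; rewrite ?(subseq_uniq sub_v) ?word_uniq // R_size.
exists p; last by apply/containsP; exists v.
have v_uniq := subseq_uniq sub_v (word_uniq q).
have [Ptab P_perm Pkn] := insertion_spec (word_uniq p).
rewrite inE; apply/eqP/hook_of_ascending => //.
  by rewrite -R_size (perm_trans P_perm) ?perm_word.
apply/(peak_reading_word r_gt0 s_gt0 Ptab)/(peak_knuth r_gt0 s_gt0 (word_uniq p) Pkn).
exact: peak_same_order peak_v.
Qed.

(** * Standard and semistandard tableaux in terms of consecutive rows *)

Lemma mem_avoiders r s n (q : 'S_n) : 0 < r -> 0 < s ->
  let R := row_superstandard (r :: nseq s.-1 1) in
  q \in avoiders n (knuth_class R) <->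
  ~ has_ascending r s (insertion_tableau q).
Proof.
move=> r_gt0 s_gt0 R; rewrite inE -(contains_knuth_class q r_gt0 s_gt0).
split=> [/forallP av [p pR qp]|av]; last first.
  by apply/forallP => p; apply/implyP => pR; apply/negP => qp; apply: av; exists p.
by have /implyP/(_ pR)/negP := av p; apply.
Qed.

Lemma nil_shape (P : filling) : (0 \in shape P) = ([::] \in P).
Proof. by elim: P => //= row P IHP; rewrite !inE IHP; case: row. Qed.

Lemma above_columns (P : filling) : [::] \notin P ->
  sorted above P <-> sorted geq (shape P) /\ columns_increasing P.
Proof.
move=> P0; split=> [abv|[shape_geq cols]].
  split; first by rewrite sorted_map; apply: sub_sorted abv => u v /aboveP[].
  move=> i j; rewrite /in_diagram => lt_j.
  have lt_i : i.+1 < size P.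
    by rewrite ltnNge; apply/negP => le_P; rewrite nth_default in lt_j.
  by have /sortedP - /(_ [::] i lt_i) /aboveP[_ /(_ j lt_j)] := abv.
apply/(sortedP [::]) => i lt_i; apply/aboveP; split; last by move=> j; apply: cols.
have := shape_geq; rewrite sorted_map => /(sortedP [::]) /(_ i lt_i); exact.
Qed.

Lemma SYTP n P : SYT n P <-> tableau ltn P /\ perm_eq (flatten P) (iota 1 n).
Proof.
split=> [[/and3P[shape_geq nil_P sum_P] P_perm rows cols]|[/and3P[P0 rows abv] P_perm]].
  rewrite nil_shape in nil_P; split=> //.
  by apply/and3P; split=> //; apply/above_columns.
have [shape_geq cols] := (above_columns P0).1 abv.
split=> //; apply/and3P; split=> //; first by rewrite nil_shape.
by rewrite -size_flatten (perm_size P_perm) size_iota.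
Qed.

Lemma SSYTP e P T : tableau e P ->
  SSYT (shape P) T <-> tableau leq T /\ shape T = shape P.
Proof.
move=> Ptab; have shape_geq := sorted_geq_tableau Ptab.
have P0 : [::] \notin P by case/and3P: Ptab.
split=> [[shape_T rows cols]|[/and3P[T0 rows abv] shape_T]].
  have T0 : [::] \notin T by rewrite -nil_shape shape_T nil_shape.
  by split=> //; apply/and3P; split=> //; apply/above_columns; rewrite // shape_T.
by split=> //; have [] := (above_columns T0).1 abv.
Qed.

Lemma finite_partitions n : finite_set [set la | is_partition n la].
Proof.
pose parts := [seq map val (val b) | b : n.-bseq 'I_n.+1].
apply: (@sub_finite_set _ _ [set` parts]); last exact: finite_seq.
move=> la /and3P[_ la0 /eqP sum_la].
have size_le : size la <= n.
  rewrite -sum_la; elim: (la) la0 => //= a l IHl; rewrite inE negb_or => /andP[a0 /IHl].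
  by rewrite eq_sym -lt0n in a0; rewrite -add1n; apply: leq_add.
have le_n a : a \in la -> a < n.+1.
  rewrite ltnS -sum_la; elim: (la) => //= b l IHl; rewrite inE => /predU1P[->|/IHl].
    exact: leq_addr.
  by move/leq_trans; apply; apply: leq_addl.
have size_b : size (map (@inord n) la) <= n by rewrite size_map.
apply/mapP; exists (Bseq size_b); first by rewrite mem_enum.
rewrite /= -map_comp -[LHS]map_id; apply/eq_in_map => a a_la /=.
by rewrite inordK ?le_n.
Qed.

(** A filling is determined by its shape and its entries read row by row. *)
Lemma finite_fillings (la : seq nat) (w : seq nat) (A : set filling) :
  (forall T, A T -> shape T = la /\ perm_eq (flatten T) w) -> finite_set A.
Proof.
move=> A_fill; pose fills := [seq reshape la v | v <- permutations w].
apply: (@sub_finite_set _ _ [set` fills]); last exact: finite_seq.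
move=> T /A_fill[shape_T T_perm]; apply/mapP; exists (flatten T).
  by rewrite mem_permutations.
by rewrite -shape_T flattenK.
Qed.

Lemma finite_tuples n (w : seq nat) (A : set (n.-tuple nat)) :
  (forall t, A t -> perm_eq t w) -> finite_set A.
Proof.
move=> A_perm; pose ts : seq (n.-tuple nat) := pmap insub (permutations w).
apply: (@sub_finite_set _ _ [set` ts]); last exact: finite_seq.
by move=> t /A_perm t_perm; rewrite /= mem_pmap_sub mem_permutations.
Qed.

Lemma perm_of_mset (s : seq nat) (m : {mset nat}%mset) :
  seq_mset s = m <-> perm_eq s m.
Proof.
split=> [<-|/eq_seq_msetP ->]; last by rewrite seq_mset_id.
by rewrite perm_sym perm_eq_seq_mset.
Qed.

(** These are the index sequences of the monomials of the fundamental
    quasisymmetric function of the descent set of [q]. *)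
Definition compatible n (q : 'S_n) (t : n.-tuple nat) : Prop :=
  sorted leq t /\
  forall j : 'I_n.-1, j \in Des q -> nth 0 t j < nth 0 t j.+1.

(** The word of [q] has no repeated letters, so where [t] stays constant it
    either ascends, as the lexicographic order demands, or descends. *)
Lemma compatible_biword n (q : 'S_n) (t : n.-tuple nat) :
  compatible q t <-> biword (zip (word q) t).
Proof.
have size_w := size_word q; have size_t := size_tuple t.
have unzip1_w : unzip1 (zip (word q) t) = word q.
  by rewrite unzip1_zip // size_w size_t.
have size_z : size (zip (word q) t) = n by rewrite size2_zip ?size_w ?size_t.
rewrite /biword unzip1_w word_uniq andbT.
have nth_z i : nth (0, 0) (zip (word q) t) i = (nth 0 (word q) i, nth 0 t i).
  by rewrite nth_zip ?size_w ?size_t.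
have neq_w i : i.+1 < n -> nth 0 (word q) i != nth 0 (word q) i.+1.
  by move=> lt_i; rewrite nth_uniq ?word_uniq ?size_w ?(ltnW lt_i) // neq_ltn ltnSn.
split=> [[/(sortedP 0) t_leq t_des]|/(sortedP (0, 0)) lex].
  apply/(sortedP (0, 0)) => i; rewrite size_z !nth_z /biletter_lt /= => lt_i.
  have := t_leq i; rewrite size_t => /(_ lt_i).
  rewrite leq_eqVlt => /orP[eq_t|->//]; rewrite eq_t /=.
  have := neq_w i lt_i; rewrite neq_ltn => /orP[->|gt_w]; first by rewrite orbT.
  have lt_i' : i < n.-1 by rewrite -ltnS prednK // (leq_trans _ lt_i).
  have := t_des (Ordinal lt_i'); rewrite inE => /(_ gt_w) /=.
  by rewrite (eqP eq_t) ltnn.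
have {}lex i : i.+1 < n -> biletter_lt (nth 0 (word q) i, nth 0 t i)
    (nth 0 (word q) i.+1, nth 0 t i.+1).
  by rewrite -!nth_z => lt_i; apply: lex; rewrite size_z.
split=> [|j].
  apply/(sortedP 0) => i; rewrite size_t => /lex /orP[/ltnW //|/andP[/eqP /= -> _]].
  exact: leqnn.
rewrite inE => gt_w; have lt_j : j.+1 < n.
  by rewrite -ltn_predRL.
by have /orP[//|/andP[_ /=]] := lex j lt_j; rewrite ltnNge ltnW.
Qed.

Lemma rsk_insertion bw : (rsk bw).1 = foldl insert [::] (unzip1 bw).
Proof.
elim/last_ind: bw => //= bw xa IHbw.
by rewrite rsk_rcons /= IHbw /unzip1 map_rcons foldl_rcons.
Qed.

(** * Counting *)

Definition fundamental_terms n (q : 'S_n) (m : monomial) : set (n.-tuple nat) :=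
  [set t | compatible q t /\ seq_mset (tval t) = m].

Definition schur_terms (la : seq nat) (m : monomial) : set filling :=
  [set T | SSYT la T /\ seq_mset (flatten T) = m].

Definition Av_shape n r s (la : seq nat) : set filling :=
  [set P | Av n r s P /\ shape P = la].

Lemma mem_fundamental_terms n (q : 'S_n) m t :
  t \in fset_set (fundamental_terms q m) <-> fundamental_terms q m t.
Proof.
rewrite in_fset_set ?inE //; apply: (@finite_tuples _ m) => t' [_].
by rewrite perm_of_mset.
Qed.

Lemma mem_schur_terms la m T :
  T \in fset_set (schur_terms la m) <-> schur_terms la m T.
Proof.
rewrite in_fset_set ?inE //; apply: (@finite_fillings la m) => T' [[-> _ _]].
by rewrite perm_of_mset.
Qed.

Lemma mem_Av_shape n r s la P :
  P \in fset_set (Av_shape n r s la) <-> Av_shape n r s la P.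
Proof.
rewrite in_fset_set ?inE //; apply: (@finite_fillings la (iota 1 n)) => P'.
by move=> [[/SYTP[_ P'_perm] _] ->].
Qed.

Lemma mem_partitions n la :
  la \in fset_set [set la | is_partition n la] <-> is_partition n la.
Proof. by rewrite in_fset_set ?inE //; apply: finite_partitions. Qed.

(** The coefficients of [m] count the pairs [(q, t)] on one side and the pairs
    [(P, T)] on the other, and the RSK correspondence is a bijection between
    them. *)
Lemma count_terms r s n m : 0 < r -> 0 < s ->
  let R := row_superstandard (r :: nseq s.-1 1) in
  \sum_(q in avoiders n (knuth_class R)) #|` fset_set (fundamental_terms q m)| =
  \sum_(la <- fset_set [set la | is_partition n la])
     #|` fset_set (schur_terms la m)| * #|` fset_set (Av_shape n r s la)|.
Proof.
move=> r_gt0 s_gt0 R.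
pose E : seq ('S_n * n.-tuple nat) :=
  [seq (q, t) | q <- enum (avoiders n (knuth_class R)),
                t <- fset_set (fundamental_terms q m)].
pose F : seq (filling * filling) :=
  [seq PT | la <- fset_set [set la | is_partition n la],
            PT <- [seq (P, T) | P <- fset_set (Av_shape n r s la),
                                T <- fset_set (schur_terms la m)]].
have size_E : size E = \sum_(q in avoiders n (knuth_class R))
    #|` fset_set (fundamental_terms q m)|.
  by rewrite size_allpairs_dep sumnE big_map big_enum.
have size_F : size F = \sum_(la <- fset_set [set la | is_partition n la])
     #|` fset_set (schur_terms la m)| * #|` fset_set (Av_shape n r s la)|.
  rewrite size_allpairs_dep sumnE big_map; apply: eq_bigr => la _.
  by rewrite size_allpairs mulnC.
have mem_E q t : (q, t) \in E <->
    q \in avoiders n (knuth_class R) /\ fundamental_terms q m t.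
  rewrite -mem_fundamental_terms; split=> [/allpairsPdep[q' [t' [+ + [-> ->]]]]|[q_av t_q]].
    by rewrite mem_enum.
  by apply/allpairsPdep; exists q, t; rewrite mem_enum.
have mem_F P T : (P, T) \in F <-> Av n r s P /\ schur_terms (shape P) m T.
  split=> [/allpairsPdep[la [_ [_ /allpairsP[[P' T'] [/= + + ->]] [-> ->]]]]|[P_Av T_P]].
    by move=> /mem_Av_shape[P'_Av <-] /mem_schur_terms.
  apply/allpairsPdep; exists (shape P), (P, T); split=> //.
    by apply/mem_partitions; case: P_Av => -[].
  apply/allpairsP; exists (P, T); split=> //; first exact/mem_Av_shape.
  exact/mem_schur_terms.
have uniq_E : uniq E.
  apply: allpairs_uniq_dep => [|q _|]; rewrite ?enum_uniq ?fset_uniq //.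
  by move=> [q t] [q' t'] _ _ /= [eq_q]; rewrite eq_q => ->.
have uniq_F : uniq F.
  apply: allpairs_uniq_dep => [|la _|]; rewrite ?fset_uniq //.
    by apply: allpairs_uniq; rewrite ?fset_uniq // => -[P T] [P' T'].
  move=> _ _ /allpairsPdep[la [[P T] [_ PT_in ->]]] /allpairsPdep[la' [[P' T'] [_ P'T'_in ->]]] /=.
  move: PT_in P'T'_in => /allpairsP[[? ?] [/= /mem_Av_shape[_ <-] _ [-> _]]].
  by move=> /allpairsP[[? ?] [/= /mem_Av_shape[_ <-] _ [-> _]]] [-> ->].
pose f (qt : 'S_n * n.-tuple nat) := rsk (zip (word qt.1) qt.2).
have zip_inj q t q' t' : zip (word q) (tval t) = zip (word q') (tval t') ->
    (q, t) = (q', t') :> 'S_n * n.-tuple nat.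
  move=> eq_zip; congr pair.
    apply: word_inj; move: (congr1 (@unzip1 _ _) eq_zip).
    by rewrite !unzip1_zip // size_word size_tuple.
  apply: val_inj; move: (congr1 (@unzip2 _ _) eq_zip).
  by rewrite !unzip2_zip // size_word size_tuple.
rewrite -size_E -size_F -(size_map f); apply: perm_size; apply: uniq_perm => //.
  rewrite map_inj_in_uniq // => -[q t] [q' t'] /mem_E[_ [/compatible_biword qt_ok _]].
  move=> /mem_E[_ [/compatible_biword q't'_ok _]] /(rsk_inj qt_ok q't'_ok).
  exact: zip_inj.
case=> P T; apply/mapP/idP => [[[q t] /mem_E[q_av [qt_ok t_m]] PT_eq]|].
  apply/mem_F; move: qt_ok => /compatible_biword qt_ok.
  have [[] ] := rsk_spec qt_ok; rewrite -[rsk _]PT_eq /=.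
  rewrite unzip1_zip ?unzip2_zip ?size_word ?size_tuple // => Ptab P_perm Ttab T_perm shape_T _.
  have P_q : P = insertion_tableau q.
    by have := rsk_insertion (zip (word q) t); rewrite -[rsk _]PT_eq unzip1_zip ?size_word ?size_tuple.
  split; last first.
    split; first by apply/(SSYTP _ Ptab).
    by rewrite -t_m; apply/eq_seq_msetP.
  split; first by apply/SYTP; rewrite (perm_trans P_perm) ?perm_word.
  by rewrite P_q; apply/(mem_avoiders q r_gt0 s_gt0).
move=> /mem_F[[/SYTP[Ptab P_perm] P_av] [/(SSYTP _ Ptab)[Ttab shape_T] T_m]].
have P_uniq : uniq (flatten P) by rewrite (perm_uniq P_perm) iota_uniq.
have [bw bw_ok rsk_bw] := rsk_surj Ptab P_uniq Ttab shape_T.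
have [[_ P_bw _ T_bw _] _] := rsk_spec bw_ok; rewrite rsk_bw /= in P_bw T_bw.
have [q q_word] : exists q : 'S_n, word q = unzip1 bw.
  by apply: word_surj; rewrite perm_sym (perm_trans _ P_bw) // perm_sym.
have t_size : size (unzip2 bw) == n.
  by rewrite size_map -(size_map fst) -/(unzip1 bw) -q_word size_word.
have zip_bw : zip (word q) (Tuple t_size) = bw by rewrite q_word zip_unzip.
exists (q, Tuple t_size); last by rewrite /f /= q_word zip_unzip.
apply/mem_E; split; last first.
  split; first by apply/compatible_biword; rewrite zip_bw.
  by rewrite -T_m; apply/eq_seq_msetP; rewrite perm_sym.
apply/(mem_avoiders q r_gt0 s_gt0).
by rewrite /insertion_tableau q_word -rsk_insertion rsk_bw.
Qed.

Theorem theorem3p2 (r s : nat) (hr : 0 < r) (hs : 0 < s) (n : nat) :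
  let R := row_superstandard (r :: nseq s.-1 1) in
  Q n (knuth_class R) =
  (\sum_(la \in [set la : seq nat | is_partition n la])
     schur la *+ Av_count n r s la)%R.
Proof.
move=> R; rewrite fsbig_finite; last exact: finite_partitions.
apply/funext => m; rewrite /Q !fct_sumE.
have natmulE (f : fps) k : (f *+ k)%R m = (f m *+ k)%R.
  by elim: k => [|k IHk]; rewrite ?GRing.mulr0n // !GRing.mulrS -IHk.
under [RHS]eq_bigr do rewrite natmulE.
transitivity (Posz (\sum_(q in avoiders n (knuth_class R))
    #|` fset_set (fundamental_terms q m)|)); last rewrite count_terms //.
  by rewrite (big_morph Posz PoszD (erefl _)).
rewrite (big_morph Posz PoszD (erefl _)); apply: eq_bigr => la _.
by rewrite PoszM -GRing.mulr_natr natz.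
Qed.
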